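(* Fix an integer $l\geq 0$ and reals $\epsilon_1,\epsilon_2>0$. There exists $M(\epsilon_1,\epsilon_2)>0$ such that for all $g>M(\epsilon_1,\epsilon_2)$ and all subsets of integers \[C\subseteq \big[1,(\gamma-\epsilon_1)g\big) \cup \big((\gamma+\epsilon_1)g,(2\gamma-\epsilon_1)g\big) \cup \big((2\gamma+\epsilon_1)g,2g\big]\] with $|C|=l$, we have \[\left|\mathbb{P}_g[C\subseteq S]-\prod_{n\in C}f_{1}\left(\frac{n}{g}\right)\right|<\epsilon_2.\]
   Context: A numerical semigroup is a submonoid of $\mathbb{N}_0$ with finite complement; its genus is the size of the complement. $\mathcal{S}_g$ is the set of numerical semigroups of genus $g$ and $\mathbb{P}_g$ is the uniform probability on $\mathcal{S}_g$, $S$ denoting a random element. Let $\gamma=\frac{5+\sqrt5}{10}$ and define $f_1:[0,2]\setminus\{\gamma,2\gamma\}\to[0,1]$ by $f_1(x)=0$ if $0\le x<\gamma$, $f_1(x)=\frac{\sqrt5-1}{2}$ if $\gamma<x<2\gamma$, and $f_1(x)=1$ if $2\gamma<x\le 2$. *)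

(* Defs.v *)
From HB Require Import structures.
From mathcomp Require Import all_boot all_order all_algebra.
From mathcomp Require Import finmap.
From mathcomp Require Import boolp classical_sets functions cardinality reals.
Set Implicit Arguments. Unset Strict Implicit. Unset Printing Implicit Defensive.
Import Order.TTheory GRing.Theory Num.Theory.
Local Open Scope classical_set_scope.
Local Open Scope ring_scope.

Definition numerical_semigroup (S : set nat) : Prop :=
  S 0%N /\ (forall a b, S a -> S b -> S (a + b)%N) /\ finite_set (~` S).

Definition genus (S : set nat) : nat := #|` fset_set (~` S)|%fset.

Definition semigroups_of_genus (g : nat) : set (set nat) :=
  [set S | numerical_semigroup S /\ genus S = g].

Definition prob_contains (R : realType) (g : nat) (C : {fset nat}) : R :=
  (#|` fset_set [set S | semigroups_of_genus g S /\
                        (forall n, (n \in C)%fset -> S n)] |%fset)%:R /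
  (#|` fset_set (semigroups_of_genus g)|%fset)%:R.

Definition gamma (R : realType) : R := (5 + Num.sqrt 5) / 10.

(* f_1; its values at the excluded points gamma, 2 gamma are irrelevant
   (set to 0 here) and are never used in the statement. *)
Definition f1 (R : realType) (x : R) : R :=
  if x < gamma R then 0
  else if (gamma R < x) && (x < 2 * gamma R) then (Num.sqrt 5 - 1) / 2
  else if 2 * gamma R < x then 1 else 0.

Definition admissible (R : realType) (e1 : R) (g n : nat) : bool :=
  [|| (1 <= n)%N && ((n%:R : R) < (gamma R - e1) * g%:R),
      ((gamma R + e1) * g%:R < n%:R) && (n%:R < (2 * gamma R - e1) * g%:R)
    | ((2 * gamma R + e1) * g%:R < n%:R) && (n%:R <= 2 * (g%:R : R))].

(* Main.v *)
(* Weight every gap by x = 1/phi, where x + x^2 = 1. Semigroups of multiplicity m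
   whose gaps are all less than 2m have total weight at most 1 for each m, and they
   already supply a constant times phi^g semigroups of genus g (words in the
   letters 1 and 2 of sum g). All that is needed beyond this is that semigroups
   with a gap at least 2m + delta g, or with m not close to gamma g, are
   exponentially rarer than phi^g.

   Let F be the Frobenius number and d a large constant. If S has at least d
   elements below F/2 - eps g, let B be the first d of them and b their maximum.
   The graph joining s to s + t (t in B) has large degree, so a greedy subset S0 of
   S of size o(g) determines sets N (contained in S) and D with S between N and D on
   ]b, F-b[ and #D <= #N + o(g). Since j and F - j are never both in S, the pairs
   {j, F-j} contribute at most phi^(#D - #N - (F-2b)/2 + o(g)). If S has fewer than
   d such elements while F >= 2m + delta g, then S contains some t of moderate size,
   and j in S implies j + t in S; for about delta g / 6 disjoint pairs (j, j+t) this
   leaves total weight 1 + x + x^2 = 2 < phi^2. The multiplicity is located by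
   Chernoff's method, that is, by moving the weight away from x.

   For the remaining semigroups, exchanging two points of the window
   ]m + k, 2m[ preserves genus, multiplicity and closure, so the points of the
   window are exchangeable; their density is about 1/phi because m is about gamma g. *)
Require Import Defs.
From HB Require Import structures.
From mathcomp Require Import finmap.
From mathcomp Require Import boolp classical_sets functions cardinality reals.
From mathcomp Require Import sequences exp.
From mathcomp Require Import all_boot all_order all_algebra perm zify ring lra.
Set Implicit Arguments. Unset Strict Implicit. Unset Printing Implicit Defensive.
Import Order.TTheory GRing.Theory Num.Theory.
Local Open Scope ring_scope.

(** * Membership and gap counting *)

(* Elements from N on count as members, so a finite set codes a cofinite one. *)
Definition ext N (A : {set 'I_N}) (n : nat) : bool :=
  if insub n is Some i then i \in A else true.

Lemma ext_ord N (A : {set 'I_N}) (i : 'I_N) : ext A i = (i \in A).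
Proof. by rewrite /ext valK. Qed.

Lemma ext_out N (A : {set 'I_N}) n : (N <= n)%N -> ext A n.
Proof. by move=> hn; rewrite /ext insubN // -leqNgt. Qed.

Lemma ext_gap N (A : {set 'I_N}) n : ~~ ext A n -> (n < N)%N.
Proof. by apply: contraR; rewrite -leqNgt; apply: ext_out. Qed.

Lemma ext_inj N (A A' : {set 'I_N}) : ext A =1 ext A' -> A = A'.
Proof. by move=> h; apply/setP => i; rewrite -!ext_ord h. Qed.

Lemma ext_set N (P : pred nat) :
  (forall n, (N <= n)%N -> P n) -> ext [set i : 'I_N | P i] =1 P.
Proof.
move=> hP n; case: (ltnP n N) => hn; last by rewrite ext_out // hP.
by rewrite (ext_ord _ (Ordinal hn)) inE.
Qed.

Lemma sum_gaps_eq N (A : {set 'I_N}) K :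
  (forall n, (K <= n)%N -> ext A n) -> (\sum_(n < K) ~~ ext A n = #|~: A|)%N.
Proof.
have all_gaps : (\sum_(n < N) ~~ ext A n = #|~: A|)%N.
  rewrite -sum1_card [RHS]big_mkcond /=; apply: eq_bigr => i _.
  by rewrite ext_ord in_setC; case: (i \in A).
have extend a b : (a <= b)%N -> (forall n, (a <= n)%N -> ext A n) ->
    (\sum_(n < b) ~~ ext A n = \sum_(n < a) ~~ ext A n)%N.
  move=> ab ha; rewrite -!(big_mkord xpredT (fun n => nat_of_bool (~~ ext A n))).
  rewrite (big_cat_nat (leq0n a) ab) /= [X in (_ + X)%N]big_nat_cond.
  by rewrite [X in (_ + X)%N]big1 ?addn0 // => i /andP[/andP[ai _] _]; rewrite ha.
move=> hK; case: (leqP N K) => NK; first by rewrite (extend N) // => n; apply: ext_out.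
by rewrite -all_gaps (extend K N) // ltnW.
Qed.

Lemma sum_gaps_le N (A : {set 'I_N}) K : (\sum_(n < K) ~~ ext A n <= #|~: A|)%N.
Proof.
rewrite -(@sum_gaps_eq _ A (maxn N K)); last first.
  by move=> n; rewrite geq_max => /andP[/ext_out].
by rewrite -!(big_mkord xpredT (fun n => nat_of_bool (~~ ext A n)))
  (big_cat_nat (leq0n K) (leq_maxr N K)) /= leq_addr.
Qed.

(** The pairs {j, F - j} with 2 j < F are those with j < [uphalf F]; for even F the midpoint is left
    alone. Removing both ends of the interval lowers F by 2, which gives the induction. *)
Lemma sum_mirror (f : nat -> nat) F :
  (\sum_(j < uphalf F) (f j + f (F - j)) + ~~ odd F * f F./2 =
   \sum_(j < F.+1) f j)%N.
Proof.
have [n] := ubnP F; elim: n F f => // n IH [|[|F]] f hF.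
- by rewrite /= !big_ord_recr !big_ord0 /=; lia.
- by rewrite /= !big_ord_recr !big_ord0 /= subn0; lia.
have := IH F (f \o succn) _; rewrite /= => /(_ ltac:(lia)) h.
rewrite big_ord_recl [RHS]big_ord_recr [in RHS]big_ord_recl /= subn0 negbK.
rewrite (eq_bigr (fun i : 'I__ => f i.+1 + f (F - i).+1)%N); last first.
  by move=> i _; congr (_ + f _)%N; have := ltn_ord i; have := uphalf_half F;
    rewrite /bump /=; lia.
have <- : (\sum_(j < F.+1) f j.+1 = \sum_(i < F.+1) f (bump 0 i))%N by [].
by rewrite -h; lia.
Qed.

Lemma sum_bool_pair (V : nmodType) (F : bool * bool -> V) :
  \sum_p F p = F (true, true) + F (true, false) + (F (false, true) + F (false, false)).
Proof.
rewrite (eq_bigr (fun p => F (p.1, p.2))); last by move=> [].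
by rewrite -(pair_bigA _ (fun a b => F (a, b))) /= big_bool !big_bool.
Qed.

(* Positions are grouped into cells of at most two, with [al j] the local patterns
   allowed in cell j; a sum over sets of products of local weights is at most the
   product of the local sums. A position beyond the range serves as a dummy partner. *)
Lemma cell_bound (R : numDomainType) (T J : finType) (Fam : {set T})
    (code : T -> J -> bool * bool) (al : J -> pred (bool * bool)) (y : R) (g : nat)
    (w : J -> R) :
  0 <= y <= 1 ->
  {in Fam &, forall A A', code A =1 code A' -> A = A'} ->
  {in Fam, forall A, forall j, al j (code A j)} ->
  {in Fam, forall A, \sum_j (~~ (code A j).1 + ~~ (code A j).2) <= g}%N ->
  (forall j, \sum_(p | al j p) y ^+ (~~ p.1 + ~~ p.2) <= w j) ->
  #|Fam|%:R * y ^+ g <= \prod_j w j.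
Proof.
move=> /andP[y0 y1] inj hal hg hw.
pose c A : {ffun J -> bool * bool} := [ffun j => code A j].
have cinj : {in Fam &, injective c}.
  by move=> A A' hA hA' /ffunP h; apply: inj => // j; have := h j; rewrite !ffunE.
(* [W] vanishes on codes with a forbidden pattern, so its sum over all codes factorises cell by
   cell. Members of [Fam] have distinct codes and hence contribute distinct terms. *)
pose W (f : {ffun J -> bool * bool}) : R :=
  \prod_j (if al j (f j) then y ^+ (~~ (f j).1 + ~~ (f j).2) else 0).
have W0 f : 0 <= W f by apply: prodr_ge0 => j _; case: ifP => // _; rewrite exprn_ge0.
apply: (@le_trans _ _ (\sum_(A in Fam) W (c A))).
  rewrite mulr_natl -sumr_const; apply: ler_sum => A hA; rewrite /W.
  rewrite (eq_bigr (fun j => y ^+ (~~ (code A j).1 + ~~ (code A j).2))).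
    by rewrite prodrXr; apply: ler_wiXn2l => //; apply: hg.
  by move=> j _; rewrite !ffunE hal.
rewrite -(big_imset _ cinj) /=.
apply: (@le_trans _ _ (\sum_f W f)).
  by rewrite [leRHS](bigID (mem (c @: Fam))) /= lerDl sumr_ge0.
rewrite /W -(bigA_distr_bigA
  (fun j (p : bool * bool) => if al j p then y ^+ (~~ p.1 + ~~ p.2) else 0)) /=.
apply: ler_prod => j _; rewrite -big_mkcond hw andbT.
by apply: sumr_ge0 => p _; rewrite exprn_ge0.
Qed.

(** * Semigroups of genus g as finite sets *)

Definition is_sg N g (A : {set 'I_N}) : Prop :=
  [/\ ext A 0, forall a b, ext A a -> ext A b -> ext A (a + b) & #|~: A| = g].

(** This range loses nothing, since the gaps of a semigroup of genus g lie below 2 g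
    ([sg_gap_lt]). *)
Definition SG g : {set {set 'I_(2 * g).+1}} := [set A | `[< is_sg g A >]].

Lemma in_SG g A : A \in SG g -> is_sg g A.
Proof. by rewrite inE => /asboolP. Qed.

Lemma sg_pair N g (A : {set 'I_N}) F j : is_sg g A -> ~~ ext A F -> (j <= F)%N ->
  ext A j -> ~~ ext A (F - j).
Proof. by move=> [_ add _] hF jF hj; apply: contra hF => h; rewrite -(subnKC jF) add. Qed.

(** Each pair {j, n - j} contains a gap, and for even n the midpoint is one as well; so at least
    half of the integers from 0 to n are gaps. *)
Lemma sg_gap_lt N g (A : {set 'I_N}) n : is_sg g A -> ~~ ext A n -> (n < 2 * g)%N.
Proof.
move=> hA hn; have [_ _ hg] := hA.
have := sum_gaps_le A n.+1; rewrite hg -(sum_mirror (fun j => nat_of_bool (~~ ext A j))) => h.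
have half : (uphalf n <= \sum_(j < uphalf n) (~~ ext A j + ~~ ext A (n - j)))%N.
  rewrite -[X in (X <= _)%N]card_ord -sum1_card; apply: leq_sum => j _.
  have jn : (j <= n)%N by have := ltn_ord j; have := uphalf_half n; lia.
  by have := sg_pair hA hn jn; case: (ext A j) => //= ->.
have : ~~ odd n -> ~~ ext A n./2.
  move=> ev; apply/negP => h2; have := sg_pair hA hn _ h2.
  by rewrite (_ : (n - n./2 = n./2)%N) ?h2 => [/(_ ltac:(lia))|]; lia.
move: (\sum_(j < uphalf n) _)%N h half => s h half.
have := odd_double_half n; have := uphalf_half n.
by case: (odd n) h => /= h hu hd => [_|/(_ isT) e]; rewrite ?e in h; lia.
Qed.

Lemma genus_ext N (A : {set 'I_N}) : genus (fun n => ext A n) = #|~: A|.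
Proof.
rewrite /genus (_ : (~` _)%classic = [set` [fset val i | i in ~: A]%fset]%classic).
  by rewrite set_fsetK card_imfset /= ?cardE //; apply: val_inj.
apply/funext => n; apply/propext; split=> /=.
  move=> /negP hn; apply/imfsetP; exists (Ordinal (ext_gap hn)) => //=.
  by rewrite in_setC -ext_ord.
by move=> /imfsetP[i /= hi ->]; rewrite ext_ord; apply/negP; rewrite -in_setC.
Qed.

Lemma finite_ext N (A : {set 'I_N}) : finite_set (~` (fun n => ext A n : Prop))%classic.
Proof.
apply: (@sub_finite_set _ _ `I_N); last exact: finite_II.
by move=> n /= /negP /ext_gap.
Qed.

Lemma semigroup_ext g S : semigroups_of_genus g S ->
  exists2 A, A \in SG g & S = (fun n => ext A n : Prop).
Proof.
move=> [[S0 [Sadd Sfin]] Sg].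
have [K hK] : exists K, forall n, (K <= n)%N -> S n.
  have /finite_fsetP[G hG] := Sfin.
  (* The sum of all gaps bounds each single gap. *)
  exists (\sum_(i <- G) i).+1 => n hn; apply: contrapT => nS.
  have nG : n \in G by have : (~` S)%classic n by []; rewrite hG.
  by move: hn; rewrite (big_rem n) //=; lia.
have restr N : (forall n, (N <= n)%N -> S n) ->
    S = (fun n => ext [set i : 'I_N | `[< S i >] ] n : Prop).
  move=> hN; apply/funext => n; apply/propext.
  rewrite (ext_set (P := fun n => `[< S n >])); last by move=> m /hN h; apply/asboolP.
  by split=> /asboolP.
have sgr N : (forall n, (N <= n)%N -> S n) -> is_sg g [set i : 'I_N | `[< S i >]].
  move=> hN; have e := restr N hN; move: S0 Sadd Sg; rewrite [in X in X -> _]e.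
  move=> S0 Sadd Sg; split => //; last by rewrite -Sg [in RHS]e genus_ext.
  by move=> a b; move: (Sadd a b); rewrite [in X in X -> _]e.
(* The gap bound is applied in the provisional range below [K]; it then shows that the range of
   [SG g] already contains every gap. *)
have hS n : ((2 * g).+1 <= n)%N -> S n.
  move=> hn; rewrite (restr K hK); apply: contraT => h.
  by have := sg_gap_lt (sgr K hK) h; lia.
exists [set i : 'I_(2 * g).+1 | `[< S i >]]; last exact: restr.
by rewrite inE; apply/asboolP; apply: sgr.
Qed.

Lemma ext_semigroup g A : A \in SG g -> semigroups_of_genus g (fun n => ext A n : Prop).
Proof.
move=> /in_SG[A0 Aadd Ag]; split; last by rewrite genus_ext.
by split; [|split; [|exact: finite_ext]].
Qed.

Lemma card_semigroups g (P : set nat -> Prop) :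
  #|` fset_set [set S | semigroups_of_genus g S /\ P S]%classic |%fset =
  #|[set A in SG g | `[< P (fun n => ext A n : Prop) >]]|.
Proof.
set Y := [set A in _ | _].
pose toset (A : {set 'I_(2 * g).+1}) : set nat := fun n => ext A n : Prop.
rewrite (_ : [set S | _]%classic = [set` [fset toset A | A in Y]%fset]%classic).
  rewrite set_fsetK card_imfset /= ?cardE // => A B hAB; apply: ext_inj => n.
  by have := congr1 (fun S : set nat => S n) hAB; rewrite /toset => /propeqP; case: ext; case: ext => // -[h h'];
    [rewrite h|rewrite h'].
apply/funext => S; apply/propext; split=> /=.
  move=> [/semigroup_ext[A hA ->] hP]; apply/imfsetP; exists A => //=.
  by rewrite inE hA /=; apply/asboolP.
by move=> /imfsetP[A /= ]; rewrite inE => /andP[hA /asboolP hP] ->; split => //; apply: ext_semigroup.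
Qed.

Lemma prob_containsE (R : realType) g (C : {fset nat}) :
  prob_contains R g C =
  #|[set A in SG g | all (ext A) C]|%:R / #|SG g|%:R.
Proof.
rewrite /prob_contains card_semigroups; congr (_%:R / _%:R).
  apply: eq_card => A; rewrite !inE; congr andb.
  by apply/asboolP/allP => h n; [move/h|move/h].
rewrite (_ : semigroups_of_genus g = [set S | semigroups_of_genus g S /\ True]%classic).
  rewrite card_semigroups; apply: eq_card => A; rewrite !inE; case: asbool => //=.
  exact: asboolT.
by apply/funext => S; apply/propext; split=> // -[].
Qed.

(** * A lower bound for the number of semigroups *)

(* Words in the letters 1 (false) and 2 (true) of sum g: the Kunz coordinates
   of the semigroups of genus g whose Frobenius number is less than twice the
   multiplicity, the latter being the length of the word plus one. *)
Fixpoint fib_words (g : nat) : seq (seq bool) :=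
  if g is g'.+1 then
    [seq false :: w | w <- fib_words g'] ++
    (if g' is g''.+1 then [seq true :: w | w <- fib_words g''] else [::])
  else [:: [::]].

Lemma fib_words_sum g (w : seq bool) : w \in fib_words g -> (size w + count id w)%N = g.
Proof.
have [n] := ubnP g; elim: n g w => // n IH [|[|g]] w hg; rewrite ?inE.
- by move=> /eqP ->.
- by move=> /eqP ->.
rewrite mem_cat => /orP[] /mapP[w' hw ->] /=.
  by rewrite add0n addSn (IH g.+1) //.
by rewrite add1n addSn addnS (IH g) //; lia.
Qed.

Lemma fib_words_uniq g : uniq (fib_words g).
Proof.
have [n] := ubnP g; elim: n g => // n IH [|[|g]] hg //.
have cons_inj b : injective (cons b : seq bool -> _) by move=> ? ? [].
have e : fib_words g.+2 = [seq false :: w | w <- fib_words g.+1] ++ [seq true :: w | w <- fib_words g].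
  by [].
rewrite e cat_uniq !map_inj_uniq //; apply/and3P; split; try by apply: IH; lia.
by apply/hasPn => _ /mapP[w _ ->]; apply/mapP => -[].
Qed.

(** The multiplicity is m = [(size w).+1]. The prepended [false] makes m a member, each letter
    [true] makes a gap between m and 2 m, and the default value of [nth] makes everything from 2 m
    on a member. *)
Definition word_mem (w : seq bool) (n : nat) : bool :=
  (n == 0) || (size w < n)%N && ~~ nth false (false :: w) (n - (size w).+1).

Lemma word_mem_ge w n : (2 * (size w).+1 <= n)%N -> word_mem w n.
Proof. by move=> h; rewrite /word_mem nth_default /=; lia. Qed.

Lemma word_mem_inj : injective (fun w => word_mem w).
Proof.
suff wlog_size w w' : word_mem w =1 word_mem w' -> (size w <= size w')%N -> w = w'.
  move=> w w' e; case: (leqP (size w) (size w')) => [|/ltnW] h; first exact: wlog_size (fun=> congr1 (@^~ _) e) h.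
  by apply/esym/wlog_size => // n; rewrite e.
move=> e; rewrite leq_eqVlt => /orP[/eqP es|lt_s]; last first.
  by have := e (size w).+1; rewrite /word_mem ltnSn subnn /=; lia.
apply: (@eq_from_nth _ false) => // i hi.
have := e ((size w).+1 + i.+1)%N; rewrite /word_mem -es addKn !addSn /=.
by rewrite ltnS leq_addr /=; do 2 case: nth.
Qed.

Lemma ext_word g (w : seq bool) : w \in fib_words g ->
  ext [set i : 'I_(2 * g).+1 | word_mem w i] =1 word_mem w.
Proof.
move=> /fib_words_sum hw.
(* A word without the letter 2 has multiplicity g + 1, and 2 (g + 1) exceeds the range; but then all
   n > g are members. *)
apply: ext_set => n hn; case: (posnP (count id w)) => [c0|c_gt0]; last first.
  by apply: word_mem_ge; move: hw c_gt0 hn; move: (count _ _) (size _) => c s; lia.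
rewrite /word_mem (_ : (size w < n)%N); last first.
  by move: hw c0 hn; move: (count _ _) (size _) => c s; lia.
apply/orP; right=> /=; move/eqP: c0; rewrite -leqn0 leqNgt -has_count.
by apply: contra => h; apply/hasP; exists true => //; move: h; case: (_ - _)%N => //= k;
  case: (ltnP k (size w)) => hk; [move=> <-; apply: mem_nth|rewrite nth_default].
Qed.

(** Closure is automatic: two nonzero members sum to at least twice the multiplicity, and there are
    no gaps from there on. *)
Lemma word_semigroup g (w : seq bool) : w \in fib_words g ->
  [set i : 'I_(2 * g).+1 | word_mem w i] \in SG g.
Proof.
move=> w_in; have hw := fib_words_sum w_in; have E := ext_word w_in.
rewrite inE; apply/asboolP; split; first by rewrite E.
  move=> a b; rewrite !E; case: (posnP a) => [->|a0]; first by rewrite add0n.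
  case: (posnP b) => [->|b0]; first by rewrite addn0.
  have big n : (0 < n)%N -> word_mem w n -> (size w < n)%N.
    by move=> n0 /orP[/eqP n_eq|/andP[]] //; rewrite n_eq in n0.
  by move=> /(big _ a0) ha /(big _ b0) hb; apply: word_mem_ge; lia.
rewrite -(@sum_gaps_eq _ _ ((size w).+1 + (size w).+1)); last first.
  by move=> n hn; rewrite E word_mem_ge //; lia.
rewrite (eq_bigr (fun n : 'I__ => nat_of_bool (~~ word_mem w n))); last by move=> n _; rewrite E.
rewrite big_split_ord /= big_ord_recl /= add0n -[RHS]hw; congr addn.
  rewrite (eq_bigr (fun=> 1%N)) ?sum1_card ?card_ord // => i _.
  by rewrite /word_mem /bump /=; have := ltn_ord i; case: ltnP => //=; lia.
rewrite -sum1_count [RHS]big_mkcond [RHS](big_nth false) big_mkord big_ord_recl /=.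
rewrite /word_mem addn0 ltnSn subnn /= add0n; apply: eq_bigr => i _.
by rewrite addKn /= /bump /= add1n addnS addSn ltnS leqW ?leq_addr //= negbK; case: nth.
Qed.

(** * The golden ratio and the Fibonacci lower bound *)

Definition invphi (R : realType) : R := (Num.sqrt 5 - 1) / 2.
Definition phi (R : realType) : R := (Num.sqrt 5 + 1) / 2.

Lemma sqrt5_sq (R : realType) : Num.sqrt 5 * Num.sqrt 5 = 5 :> R.
Proof. by rewrite -expr2 sqr_sqrtr. Qed.

Lemma sqrt5_bounds (R : realType) : 2236 / 1000 < (Num.sqrt 5 : R) < 2237 / 1000.
Proof.
have s := sqrt5_sq R; have s0 : 0 <= (Num.sqrt 5 : R) := sqrtr_ge0 _.
by apply/andP; split; nra.
Qed.

Lemma invphi_sq (R : realType) : invphi R + invphi R ^+ 2 = 1.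
Proof. by rewrite /invphi; have := sqrt5_sq R; nra. Qed.

Lemma phiE (R : realType) : phi R = 1 + invphi R.
Proof. by rewrite /phi /invphi; lra. Qed.

Lemma invphiM (R : realType) : invphi R * phi R = 1.
Proof. by rewrite phiE mulrDr mulr1 -expr2 invphi_sq. Qed.

Lemma invphi_bounds (R : realType) : 618 / 1000 < invphi R < 6185 / 10000.
Proof. by rewrite /invphi; have /andP[? ?] := sqrt5_bounds R; lra. Qed.

Lemma phi_bounds (R : realType) : 1618 / 1000 < phi R < 16185 / 10000.
Proof. by rewrite /phi; have /andP[? ?] := sqrt5_bounds R; lra. Qed.

(** Both sides satisfy the Fibonacci recursion, as phi^2 = phi + 1; the constant 2 covers g = 0 and
    g = 1. *)
Lemma fib_words_size (R : realType) g : phi R ^+ g <= 2 * (size (fib_words g))%:R.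
Proof.
have [n] := ubnP g; elim: n g => // n IH [|[|g]] hg.
- by rewrite expr0 /=; lra.
- by rewrite expr1 /=; have /andP[_] := phi_bounds R; lra.
have e : fib_words g.+2 = [seq false :: w | w <- fib_words g.+1] ++ [seq true :: w | w <- fib_words g].
  by [].
rewrite e size_cat !size_map natrD mulrDr.
have -> : phi R ^+ g.+2 = phi R ^+ g.+1 + phi R ^+ g.
  have : phi R * phi R = phi R + 1 by have := invphiM R; rewrite phiE; nra.
  by rewrite !exprS mulrA => ->; rewrite mulrDl mul1r.
by apply: lerD; apply: IH; lia.
Qed.

Lemma card_SG_ge (R : realType) g : phi R ^+ g <= 2 * #|SG g|%:R.
Proof.
apply: le_trans (fib_words_size R g) _; rewrite ler_pM2l // ler_nat.
pose f w := [set i : 'I_(2 * g).+1 | word_mem w i].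
rewrite -(size_map f) cardE; apply: uniq_leq_size; last first.
  by move=> _ /mapP[w hw ->]; rewrite mem_enum word_semigroup.
rewrite map_inj_in_uniq ?fib_words_uniq // => w w' hw hw' e.
by apply: word_mem_inj; apply/funext => n; rewrite -(ext_word hw) -(ext_word hw') -/(f w) e.
Qed.

(** * Containers *)

Lemma sum_interval K a b : (\sum_(j < K) (a <= j < b) = minn b K - a)%N.
Proof. by elim: K => [|K IH]; rewrite ?big_ord0 ?big_ord_recr /= ?IH; lia. Qed.

Lemma sum_ext_le N (X : {set 'I_N}) K : (K <= N)%N -> (\sum_(j < K) ext X j <= #|X|)%N.
Proof.
move=> KN; rewrite (big_ord_widen N (fun j => nat_of_bool (ext X j)) KN) big_mkcond /=.
rewrite -sum1_card [leqRHS]big_mkcond /=; apply: leq_sum => i _.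
by rewrite ext_ord; case: (_ \in X); case: (_ < _)%N.
Qed.

Lemma sum_ext_eq N (X : {set 'I_N}) K : (K <= N)%N -> {in X, forall i : 'I_N, (i < K)%N} ->
  (\sum_(j < K) ext X j = #|X|)%N.
Proof.
move=> KN hX; rewrite (big_ord_widen N (fun j => nat_of_bool (ext X j)) KN) big_mkcond /=.
rewrite -sum1_card [RHS]big_mkcond /=; apply: eq_bigr => i _.
by rewrite ext_ord; case: (boolP (i \in X)) => [/hX ->|] //; case: (_ < _)%N.
Qed.

Lemma sum_shift (f : nat -> nat) K t :
  (\sum_(j < K | j + t < K) f (j + t) = \sum_(t <= j < K) f j)%N.
Proof.
rewrite -[in RHS](add0n t) big_addn big_mkord.
rewrite (big_ord_widen K (fun j => f (j + t)%N) (leq_subr t K)).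
by apply: eq_bigl => j; lia.
Qed.

Lemma sum_shift_le (f : nat -> nat) K t :
  (\sum_(j < K | j + t < K) f (j + t) <= \sum_(j < K) f j)%N.
Proof.
rewrite sum_shift -(big_mkord xpredT); case: (leqP t K) => tK.
  by rewrite (big_cat_nat (leq0n t) tK) /= leq_addl.
by rewrite big_geq // ltnW.
Qed.

Definition sumset N (S B : {set 'I_N}) : {set 'I_N} :=
  [set n : 'I_N | [exists s in S, exists t in B, n == (s + t)%N :> nat]].

Lemma sumsetP N (S B : {set 'I_N}) (n : 'I_N) :
  reflect (exists2 s, s \in S & exists2 t, t \in B & n = (s + t)%N :> nat) (n \in sumset S B).
Proof.
rewrite inE; apply: (iffP exists_inP) => -[s hs].
  by move=> /exists_inP[t ht /eqP e]; exists s => //; exists t.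
by move=> [t ht e]; exists s => //; apply/exists_inP; exists t => //; apply/eqP.
Qed.

(* The points most of whose translates by B lie in N0: every s in the semigroup with
   few new sums is one of them. *)
Definition container N (b F h : nat) (B N0 : {set 'I_N}) : {set 'I_N} :=
  [set s : 'I_N | [&& (b < s)%N, (s + b < F)%N &
    (#|[set t in B | ~~ ext N0 (s + t)]| < h)%N]].

(** Count the pairs (s, t) with s in the container, t in B and s + t in [N0]. Each s occurs in at
    least h^2 - h of them and each t in at most [#|N0|]. Dividing by h and bounding one copy of the
    container by F gives the claim. *)
Lemma container_card N b F h (B N0 : {set 'I_N}) :
  (0 < h)%N -> {in B, forall t : 'I_N, (t <= b)%N} -> #|B| = (h ^ 2)%N -> (F < N)%N ->
  (h * #|container b F h B N0| <= h * #|N0| + F)%N.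
Proof.
move=> h0 hB cB FN; set D := container _ _ _ _ _.
have DF : (#|D| <= F)%N.
  apply: leq_trans (_ : #|[set i : 'I_N | (i < F)%N]| <= F)%N.
    by apply/subset_leq_card/subsetP => i; rewrite !inE => /and3P[_ + _]; lia.
  rewrite -sum1dep_card big_mkcond /= (eq_bigr (fun i : 'I_N => nat_of_bool (0 <= i < F)%N)).
    by rewrite sum_interval; lia.
  by move=> i _; case: ltnP.
have lower : (#|D| * (h ^ 2 - h) <= \sum_(s in D) #|[set t in B | ext N0 (s + t)]|)%N.
  rewrite -sum_nat_const; apply: leq_sum => s; rewrite inE => /and3P[_ _ hs].
  have := cardsID [set t : 'I_N | ext N0 (s + t)] B; rewrite cB.
  rewrite (_ : B :&: _ = [set t in B | ext N0 (s + t)]); last by apply/setP => t; rewrite !inE.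
  rewrite (_ : B :\: _ = [set t in B | ~~ ext N0 (s + t)]); last first.
    by apply/setP => t; rewrite !inE andbC.
  by move: hs; move: #|_| => u; move: #|_| (h ^ 2)%N => v H; lia.
have upper : (\sum_(s in D) #|[set t in B | ext N0 (s + t)]| <= h ^ 2 * #|N0|)%N.
  rewrite (eq_bigr (fun s : 'I_N => \sum_(t in B) ext N0 (s + t))%N); last first.
    move=> s _; rewrite -sum1_card big_mkcond [RHS]big_mkcond; apply: eq_bigr => t _.
    by rewrite inE; case: (t \in B); case: ext.
  rewrite exchange_big /= -cB -sum_nat_const; apply: leq_sum => t tB.
  apply: leq_trans (sum_ext_le N0 (leqnn N)).
  apply: leq_trans (sum_shift_le (fun n => nat_of_bool (ext N0 n)) N t).
  rewrite big_mkcond [leqRHS]big_mkcond; apply: leq_sum => s _.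
  case: ifP => //; rewrite inE => /and3P[_ sF _].
  by have := hB _ tB; case: ltnP => //; lia.
have : (h * ((h - 1) * #|D|) <= h * (h * #|N0|))%N.
  have := leq_trans lower upper; rewrite mulnA -[in X in (_ <= X)%N -> _]mulnn -mulnA.
  by rewrite mulnC mulnBr muln1 mulnn.
rewrite leq_pmul2l // mulnBl mul1n; lia.
Qed.

(* Greedy choice: a maximal S0 with h #|S0| <= #|S0 + B|; any further element
   of A contributes fewer than h new sums. *)
Lemma container_exists n b F h (A B : {set 'I_n.+1}) :
  (0 < h)%N -> (F <= n)%N -> {in B, forall t : 'I__, (t <= b)%N} ->
  exists S0 : {set 'I_n.+1},
    [/\ {in S0, forall s : 'I__, [/\ s \in A, (b < s)%N & (s + b < F)%N]},
        (h * #|S0| <= #|sumset S0 B|)%N &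
        {in A, forall s : 'I__, (b < s)%N -> (s + b < F)%N ->
           s \in container b F h B (sumset S0 B)}].
Proof.
move=> h0 Fn hB.
pose P (S : {set 'I_n.+1}) := [forall s in S, [&& s \in A, (b < s)%N & (s + b < F)%N]] &&
  (h * #|S| <= #|sumset S B|)%N.
have [S0 /maxsetP[/andP[/forall_inP hS0 hc] hmax]] : {S | maxset P S}.
  apply: ex_maxset; exists set0; rewrite /P cards0 muln0 andbT.
  by apply/forall_inP => s; rewrite inE.
exists S0; split=> //; first by move=> s /hS0 /and3P[].
move=> s sA bs sF; rewrite inE bs sF /= ltnNge; apply/negP => hK.
set K := [set t in B | _] in hK.
have K_in t : t \in K -> (s + t <= n)%N.
  by rewrite inE => /andP[/hB tb _]; lia.
pose f (t : 'I_n.+1) : 'I_n.+1 := inord (s + t).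
have fE t : t \in K -> f t = (s + t)%N :> nat by move=> /K_in h1; rewrite inordK.
have cK : #|f @: K| = #|K|.
  apply: card_in_imset => t t' ht ht' e; apply: val_inj => /=.
  by apply/eqP; rewrite -(eqn_add2l s) -!fE // e.
(* For s in [S0] all sums s + t are already present, so [K] would be empty, contrary to
   [h <= #|K|]. *)
have s_notin : s \notin S0.
  apply/negP => sS; have : K = set0.
    apply/setP => t; rewrite !inE; apply/negP => /andP[tB] /negP[].
    have tb := hB _ tB; have st : (s + t < n.+1)%N by lia.
    rewrite (ext_ord _ (Ordinal st)); apply/sumsetP; exists s => //; by exists t.
  by move=> K0; move: hK; rewrite K0 cards0 leqNgt h0.
suff : s |: S0 = S0 by move/setP/(_ s); rewrite setU11 (negbTE s_notin).
apply: hmax; last exact: subsetUr.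
apply/andP; split.
  by apply/forall_inP => i /setU1P[->|/hS0 //]; rewrite sA bs sF.
rewrite cardsU1 s_notin mulnDr muln1.
apply: leq_trans (leq_add hK hc) _; rewrite -cK.
rewrite -cardsUI (_ : _ :&: _ = set0) ?cards0 ?addn0; last first.
  apply/setP => i; rewrite in_set0; apply/negP => /setIP[/imsetP[t tK ->]].
  by rewrite -ext_ord fE //; apply/negP; move: tK; rewrite inE => /andP[].
apply/subset_leq_card/subsetP => i /setUP[/imsetP[t tK ->]|/sumsetP[s' hs' [t ht e]]].
  by apply/sumsetP; exists s; [rewrite setU11|exists t; [move: tK; rewrite inE => /andP[]|rewrite fE]].
by apply/sumsetP; exists s'; [rewrite setU1r|exists t].
Qed.

(** The first place is prescribed, with weight 1 for a member and x for a gap. The second is free,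
    with total weight 1 + x = 1/x, or forced to be a member, with weight 1. *)
Lemma low_cell (R : realFieldType) (x : R) (beta nu : bool) :
  0 < x < 1 -> x + x ^+ 2 = 1 ->
  \sum_(p | (p.1 == beta) && (nu ==> p.2)) x ^+ (~~ p.1 + ~~ p.2)
    <= (1 + x) ^+ beta * x ^+ nu.
Proof.
move=> /andP[x0 x1] e; rewrite big_mkcond sum_bool_pair; case: beta; case: nu => /=;
  rewrite ?expr0 ?expr1 ?mul1r ?mulr1 -1?expr2 ?mulrDl ?mul1r -?expr2 ?addn0; lra.
Qed.

(** Here [d1], [d2] permit membership, [n1], [n2] force it, and both places are never members
    together. The three patterns of an unrestricted cell weigh 2 x + x^2 = 1 + x = (1 + x)^2 x; each
    restriction lowers the total by a factor 1 + x at least. *)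
Lemma mid_cell (R : realFieldType) (x : R) (d1 d2 n1 n2 : bool) :
  0 < x < 1 -> x + x ^+ 2 = 1 ->
  \sum_(p | [&& ~~ (p.1 && p.2), n1 ==> p.1, n2 ==> p.2, p.1 ==> d1 & p.2 ==> d2])
     x ^+ (~~ p.1 + ~~ p.2) <= (1 + x) ^+ (d1 + d2) * x ^+ (n1 + n2 + 1).
Proof.
move=> /andP[x0 x1] e.
have x_half : 1 <= x *+ 2 by nra.
have e2 : x ^+ 2 = 1 - x by rewrite -e addrC addKr.
have e3 : x ^+ 3 = x *+ 2 - 1 by rewrite exprS e2 mulrBr mulr1 -expr2 e2 opprB addrA mulr2n.
have xp : x * (1 + x) = 1 by rewrite mulrDr mulr1 -expr2.
have shift a b : (1 + x) ^+ a.+1 * x ^+ b.+1 = (1 + x) ^+ a * x ^+ b.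
  by rewrite exprSr exprS mulrA -(mulrA (_ ^+ a)) [(1 + x) * _]mulrC xp mulr1.
rewrite big_mkcond sum_bool_pair /=.
case: d1; case: d2; case: n1; case: n2 => /=;
  rewrite ?(addn0, add0n, addn1, shift, expr0, mul1r, mulr1, expr1) ?e3 ?e2; lra.
Qed.

(** * Weighted counts of three families of semigroups *)

Lemma ltn_uphalf n F : (n < uphalf F)%N = (2 * n < F)%N.
Proof. by have := uphalf_half F; lia. Qed.

Lemma sub_ltn_uphalf n F : (F < 2 * n)%N -> (n <= F)%N -> (F - n < uphalf F)%N.
Proof. by rewrite ltn_uphalf; lia. Qed.

Lemma leq_half n : (n./2 <= n)%N.
Proof. lia. Qed.

Lemma sub_middle n F : (F <= 2 * n)%N -> (2 * n <= F)%N -> (F - n = n)%N.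
Proof. lia. Qed.

Lemma golden_inv (R : realFieldType) (x : R) : x + x ^+ 2 = 1 -> x * (1 + x) = 1.
Proof. by move=> e; rewrite mulrDr mulr1 -expr2. Qed.

Lemma golden_clear (R : realFieldType) (x y : R) g a b :
  0 < x < 1 -> x + x ^+ 2 = 1 -> y * x ^+ g <= (1 + x) ^+ a * x ^+ b ->
  y * (1 + x) ^+ b <= (1 + x) ^+ (g + a).
Proof.
move=> /andP[x0 _] e h; have xp := golden_inv e.
have f0 n : 0 <= (1 + x) ^+ n by rewrite exprn_ge0 // addr_ge0 // ltW.
have xf n : x ^+ n * (1 + x) ^+ n = 1 by rewrite -exprMn xp expr1n.
have := ler_wpM2r (f0 (g + b)%N) h.
rewrite exprD mulrA -(mulrA y) xf mulr1 [(1 + x) ^+ g * _]mulrC mulrA -(mulrA (_ ^+ a)) xf mulr1.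
by rewrite -exprD addnC.
Qed.

(** The semigroups with fingerprint (F, b, B, S0): F is the Frobenius number, and between b and F -
    b the members lie above [sumset S0 B] and inside its container. *)
Definition containerFam g F b h (B S0 : {set 'I_(2 * g).+1}) : {set {set 'I_(2 * g).+1}} :=
  [set A in SG g | `[< [/\ ~~ ext A F, forall n, (F < n)%N -> ext A n,
     forall n, (n <= b)%N -> ext A n = (n == 0%N) || ext B n,
     S0 \subset A &
     {in A, forall s : 'I__, (b < s)%N -> (s + b < F)%N ->
       s \in container b F h B (sumset S0 B)}] >]].

(* The cells are the pairs (j, F - j) with 2 j < F. *)
Lemma card_containerFam (R : realFieldType) (x : R) g F b h (B S0 : {set 'I_(2 * g).+1}) :
  0 < x < 1 -> x + x ^+ 2 = 1 ->
  (2 * b < F)%N -> (F < (2 * g).+1)%N -> {in B, forall t : 'I__, (t <= b)%N} ->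
  {in S0, forall s : 'I__, (b < s)%N /\ (s + b < F)%N} ->
  #|containerFam F b h B S0|%:R * (1 + x) ^+ (#|sumset S0 B| + (uphalf F - b.+1))
    <= (1 + x) ^+ (g + (#|B|.+1 + #|container b F h B (sumset S0 B)|)).
Proof.
move=> hx e bF FN hB hS0; set Fam := containerFam _ _ _ _ _; set N0 := sumset _ _.
set D := container _ _ _ _ _; have [x0 x1] := andP hx.
have FamP A : A \in Fam -> A \in SG g /\ [/\ ~~ ext A F, forall n, (F < n)%N -> ext A n,
     forall n, (n <= b)%N -> ext A n = (n == 0%N) || ext B n,
     S0 \subset A &
     {in A, forall s : 'I__, (b < s)%N -> (s + b < F)%N -> s \in D}].
  by rewrite inE => /andP[hA /asboolP].
have N0_in A n : A \in Fam -> (n <= F)%N -> ext N0 n -> ext A n.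
  move=> /FamP[/in_SG[_ add _] [_ _ low S0A _]] nF.
  have nN : (n < (2 * g).+1)%N by lia.
  rewrite (ext_ord _ (Ordinal nN)) => /sumsetP[s hs [t ht /= ->]].
  by apply: add; [rewrite ext_ord (subsetP S0A)|rewrite low ?hB // ext_ord ht orbT].
have N0_range : {in N0, forall n : 'I__, (b < n < F)%N}.
  by move=> n /sumsetP[s /hS0[? ?] [t /hB ? ->]]; lia.
have D_in A n : A \in Fam -> (b < n)%N -> (n + b < F)%N -> ext A n -> ext D n.
  move=> /FamP[_ [_ _ _ _ hD]] bn nF.
  have nN : (n < (2 * g).+1)%N by lia.
  by rewrite !(ext_ord _ (Ordinal nN)) => /hD; apply.
have f0 n : 0 <= (1 + x) ^+ n by rewrite exprn_ge0 // addr_ge0 // ltW.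
(* The member [A0] serves below to exclude the midpoint [F./2] from [N0]. *)
case: (set_0Vmem Fam) => [->|[A0 A0_in]]; first by rewrite cards0 mul0r.
(* Exponents of the cell bounds: [a] counts places where membership is prescribed or permitted, [c]
   those where it is forced; the extra 1 in [c] comes from j and F - j not both being members. *)
pose a (j : 'I_(uphalf F)) : nat :=
  if (j <= b)%N then nat_of_bool ((j == 0%N :> nat) || ext B j) else (ext D j + ext D (F - j))%N.
pose c (j : 'I_(uphalf F)) : nat :=
  if (j <= b)%N then nat_of_bool (ext N0 (F - j)) else (ext N0 j + ext N0 (F - j) + 1)%N.
have uF (j : 'I_(uphalf F)) : (2 * j < F)%N by have := ltn_ord j; rewrite ltn_uphalf.
have key : #|Fam|%:R * x ^+ g <= (1 + x) ^+ (\sum_j a j) * x ^+ (\sum_j c j).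
  rewrite -!prodrXr -big_split /=.
  refine (@cell_bound R _ _ Fam (fun A (j : 'I_(uphalf F)) => (ext A j, ext A (F - j)))
    (fun j p => if (j <= b)%N
       then (p.1 == ((j == 0%N :> nat) || ext B j)) && (ext N0 (F - j) ==> p.2)
       else [&& ~~ (p.1 && p.2), ext N0 j ==> p.1, ext N0 (F - j) ==> p.2,
              p.1 ==> ext D j & p.2 ==> ext D (F - j)]) x g
    (fun j => (1 + x) ^+ a j * x ^+ c j) _ _ _ _ _).
  - by rewrite !ltW.
  - move=> A A' hA hA' eA; apply: ext_inj => n.
    have [sA [nF hF _ _ _]] := FamP _ hA; have [sA' [nF' hF' _ _ _]] := FamP _ hA'.
    case: (ltnP F n) => Fn; first by rewrite hF ?hF'.
    case: (ltnP (2 * n) F) => nF2.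
      have hn : (n < uphalf F)%N by rewrite ltn_uphalf.
      by have [] := eA (Ordinal hn).
    case: (ltnP F (2 * n)) => nF3.
      have hn : (F - n < uphalf F)%N by apply: sub_ltn_uphalf.
      by have [_] := eA (Ordinal hn); rewrite /= subKn.
    (* For even F the midpoint lies in no cell, but it is always a gap because its double is F. *)
    have mid A1 : is_sg g A1 -> ~~ ext A1 F -> ext A1 n = false.
      move=> s1 h1; apply/negP => h2; have := sg_pair s1 h1 Fn h2.
      by rewrite sub_middle ?h2.
    by rewrite !mid //; apply: in_SG.
  - move=> A hA j; have [sA [nF hF low _ _]] := FamP _ hA; have jF := uF j.
    have hN n : (n <= F)%N -> ext N0 n ==> ext A n.
      by move=> nF'; apply/implyP; apply: N0_in.
    case: leqP => bj /=; first by rewrite low // eqxx hN // leq_subr.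
    rewrite !hN ?leq_subr //=; last by lia.
    apply/and3P; split.
    + apply/negP => /andP[h1 h2].
      by have := sg_pair (in_SG sA) nF _ h1; rewrite h2 => /(_ ltac:(lia)).
    + by apply/implyP; apply: (D_in A) => //; lia.
    + by apply/implyP; apply: (D_in A) => //; lia.
  - move=> A hA; have [/in_SG[_ _ hg] _] := FamP _ hA.
    rewrite -[leqRHS]hg; apply: leq_trans (sum_gaps_le A F.+1).
    by rewrite -(sum_mirror (fun n => nat_of_bool (~~ ext A n))) leq_addr.
  - move=> j; rewrite /a /c; case: leqP => bj.
      exact: (low_cell ((j == 0%N :> nat) || ext B j)).
    exact: mid_cell.
have sum_a : (\sum_j a j <= #|B|.+1 + #|D|)%N.
  apply: leq_trans (_ : (\sum_(j < uphalf F) (j == 0%N :> nat) + \sum_(j < uphalf F) ext B j +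
     \sum_(j < uphalf F) (ext D j + ext D (F - j))) <= _)%N.
    rewrite -!big_split /=; apply: leq_sum => j _; rewrite /a.
    by case: (leqP j b) => _; case: (j == 0%N :> nat);
      case: (ext B j); case: (ext D j); case: (ext D (F - j)).
  apply: leq_add.
    rewrite -[#|B|.+1]add1n; apply: leq_add; last first.
      by apply: sum_ext_le; have := uphalf_half F; lia.
    by case: (uphalf F) => [|k]; rewrite ?big_ord0 // big_ord_recl big1.
  apply: leq_trans (sum_ext_le D FN).
  by rewrite -(sum_mirror (fun n => nat_of_bool (ext D n))) leq_addr.
have sum_c : (#|N0| + (uphalf F - b.+1) <= \sum_j c j)%N.
  rewrite -(sum_ext_eq FN); last by move=> n /N0_range; lia.
  rewrite -(sum_mirror (fun n => nat_of_bool (ext N0 n))) (_ : ~~ odd F * _ = 0)%N; last first.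
    case: (boolP (odd F)) => //= ev; rewrite mul1n; apply/eqP; rewrite eqb0; apply/negP => h2.
    have [/in_SG sA [nF _ _ _ _]] := FamP _ A0_in.
    have h3 : ext A0 F./2 by apply: N0_in h2 => //; apply: leq_half.
    have half_le : (F./2 <= F)%N by apply: leq_half.
    by have := sg_pair sA nF half_le h3; rewrite sub_middle ?h3 //; lia.
  have <- : (\sum_(j < uphalf F) (b.+1 <= j < uphalf F) = uphalf F - b.+1)%N.
    by rewrite sum_interval minnn.
  rewrite addn0 -big_split /=; apply: leq_sum => j _; rewrite /c ltn_ord andbT.
  case: (leqP j b) => bj; last by rewrite addn1.
  rewrite addn0 (_ : ext N0 j = false) //; apply/negP => hj.
  have jN : (j < (2 * g).+1)%N by have := uF j; lia.
  by move: hj; rewrite (ext_ord _ (Ordinal jN)) => /N0_range /=; lia.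
have f1 : 1 <= 1 + x by rewrite lerDl ltW.
apply: le_trans (_ : _ <= (1 + x) ^+ (g + \sum_j a j)) _; last first.
  by rewrite ler_weXn2l // leq_add2l.
apply: le_trans (golden_clear hx e key).
by rewrite ler_wpM2l ?ler0n // ler_weXn2l.
Qed.

(* The initial segment up to p is prescribed by B; closure is only used through
   addition of t. *)
Definition sparseFam g F p t (B : {set 'I_(2 * g).+1}) : {set {set 'I_(2 * g).+1}} :=
  [set A in SG g | `[< [/\ ext A t, forall n, (F < n)%N -> ext A n &
     forall n, (n <= p)%N -> ext A n = (n == 0%N) || ext B n] >]].

(* The cells are the pairs (j, j + t) with p < j <= p + n, and single points. *)
Lemma card_sparseFam (R : realFieldType) (x : R) g F p t n (B : {set 'I_(2 * g).+1}) :
  0 < x < 1 -> x + x ^+ 2 = 1 ->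
  (F < (2 * g).+1)%N -> (n <= t)%N -> (p + n + t <= F)%N ->
  #|sparseFam F p t B|%:R * (1 + x) ^+ p.+1
    <= (1 + x) ^+ (g + (#|B|.+1 + (F - p - 2 * n))) * 2 ^+ n.
Proof.
move=> hx e FN nt ptF; set Fam := sparseFam _ _ _ _; have [x0 x1] := andP hx.
have FamP A : A \in Fam -> A \in SG g /\ [/\ ext A t, forall n, (F < n)%N -> ext A n &
     forall n, (n <= p)%N -> ext A n = (n == 0%N) || ext B n].
  by rewrite inE => /andP[hA /asboolP].
(* [lead] marks the first points j of the pairs and [dup] the second points j + t. A second point is
   read in the cell of j and replaced by a dummy member in its own cell; [n <= t] keeps the two
   ranges disjoint. *)
pose dup j := (p + t < j <= p + t + n)%N.
pose lead j := (p < j <= p + n)%N.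
pose u j := if dup j then (2 * g).+1 else j.
pose v j := if lead j then (j + t)%N else (2 * g).+1.
pose a (j : 'I_F.+1) : nat := if (j <= p)%N then nat_of_bool ((j == 0%N :> nat) || ext B j)
  else nat_of_bool (~~ lead j && ~~ dup j).
have key : #|Fam|%:R * x ^+ g <= (1 + x) ^+ (\sum_j a j) *
    x ^+ (\sum_(j < F.+1) (j <= p)%N) * 2 ^+ (\sum_(j < F.+1) lead j).
  rewrite -!prodrXr -!big_split /=.
  refine (@cell_bound R _ _ Fam (fun A (j : 'I_F.+1) => (ext A (u j), ext A (v j)))
    (fun j q => if (j <= p)%N then (q.1 == ((j == 0%N :> nat) || ext B j)) && (true ==> q.2)
       else if lead j then q.1 ==> q.2 else if dup j then q.1 && q.2 else q.2) x g
    (fun j => (1 + x) ^+ a j * x ^+ (j <= p)%N * 2 ^+ lead j) _ _ _ _ _).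
  - by rewrite !ltW.
  - move=> A A' /FamP[_ [_ hF _]] /FamP[_ [_ hF' _]] eA; apply: ext_inj => i.
    case: (ltnP F i) => iF; first by rewrite hF ?hF'.
    case: (boolP (dup i)) => di; last first.
      by have [] := eA (Ordinal (iF : (i < F.+1)%N)); rewrite /= /u (negbTE di).
    have hi : (i - t < F.+1)%N by rewrite ltnS (leq_trans (leq_subr _ _)).
    have [_] := eA (Ordinal hi); rewrite /= /v ifT ?subnK //.
      by move: di; rewrite /dup; clear; lia.
    by move: di; rewrite /dup /lead; clear; lia.
  - move=> A /FamP[/in_SG[_ add _] [At _ low]] j.
    have oN : ext A (2 * g).+1 by rewrite ext_out.
    case: leqP => jp /=.
      rewrite /u /v ifF ?ifF; first by rewrite low // eqxx oN.
        by rewrite /lead ltnNge jp.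
      by rewrite /dup; move: jp; clear; lia.
    rewrite /u /v; case: (boolP (lead j)) => lj.
      have -> : dup j = false by move: lj nt; rewrite /dup /lead; clear; lia.
      by apply/implyP => h; apply: add.
    by case: (dup j) => /=; rewrite oN.
  - move=> A /FamP[/in_SG[_ _ hg] _].
    rewrite -[leqRHS]hg; apply: leq_trans (sum_gaps_le A F.+1).
    rewrite big_split /=.
    apply: leq_trans (_ : (\sum_(j < F.+1) (~~ dup j && ~~ ext A j) +
      \sum_(j < F.+1) (dup j && ~~ ext A j) <= _)%N); last first.
      by rewrite -big_split /=; apply: leq_sum => j _; case: (dup j); case: ext.
    apply: leq_add.
      by apply: leq_sum => j _; rewrite /u; case: (dup j) => //=; rewrite ext_out.
    apply: leq_trans (sum_shift_le (fun j => nat_of_bool (dup j && ~~ ext A j)) F.+1 t).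
    rewrite [leqRHS]big_mkcond; apply: leq_sum => j _; rewrite /v.
    case: (boolP (lead j)) => lj; last by rewrite ext_out.
    rewrite (_ : dup (j + t)%N) /=; last by move: lj; rewrite /lead /dup; clear; lia.
    by rewrite ifT //; move: lj ptF; rewrite /lead; clear; lia.
  - move=> j; rewrite /a /lead; case: (leqP j p) => jp /=.
      rewrite expr0 mulr1.
      exact: (low_cell ((j == 0%N :> nat) || ext B j) true).
    (* A pair (j, j + t) may be both members, only the second, or neither: total weight 1 + x + x^2
       = 2. *)
    rewrite expr0 mulr1 big_mkcond sum_bool_pair.
    by case: (j <= p + n)%N; case: (dup j) => /=; rewrite ?expr0 ?expr1 ?mul1r ?mulr1; lra.
have sum_a : (\sum_j a j <= #|B|.+1 + (F - p - 2 * n))%N.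
  suff : (\sum_j a j + 2 * n <= #|B|.+1 + (F - p))%N by move: ptF nt; clear; lia.
  have -> : (2 * n = \sum_(j < F.+1) (p.+1 <= j < (p + n).+1)%N +
                     \sum_(j < F.+1) ((p + t).+1 <= j < (p + t + n).+1)%N)%N.
    by rewrite !sum_interval; move: ptF; clear; lia.
  have -> : (F - p = \sum_(j < F.+1) (p.+1 <= j < F.+1)%N)%N.
    by rewrite !sum_interval; move: ptF; clear; lia.
  apply: leq_trans (_ : (\sum_(j < F.+1) (j == 0%N :> nat) + \sum_(j < F.+1) ext B j +
     \sum_(j < F.+1) (p.+1 <= j < F.+1)%N <= _)%N).
    rewrite -!big_split /=; apply: leq_sum => j _; rewrite /a ltn_ord andbT !ltnS -/(lead j) -/(dup j).
    case: (leqP j p) => jp.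
      rewrite /lead /dup ltnNge jp (_ : (p + t < j)%N = false) //; last by move: jp; clear; lia.
      by case: (j == 0%N :> nat); case: ext.
    have : ~~ (lead j && dup j) by move: nt; rewrite /lead /dup; clear; lia.
    by case: (lead j); case: (dup j); case: (j == 0%N :> nat); case: ext.
  rewrite leq_add2r -[#|B|.+1]add1n; apply: leq_add; last exact: sum_ext_le.
  by rewrite big_ord_recl big1.
have sum_b : (\sum_(j < F.+1) (j <= p) = p.+1)%N.
  have := sum_interval F.+1 0 p.+1; rewrite subn0 (minn_idPl _); first by [].
  by move: ptF; clear; lia.
have sum_c : (\sum_(j < F.+1) lead j = n)%N.
  have := sum_interval F.+1 p.+1 (p + n).+1; rewrite /lead; move: ptF; clear => ptF ->; lia.
rewrite sum_b sum_c in key.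
have f1 : 1 <= 1 + x by rewrite lerDl ltW.
have tw : 0 < 2 ^+ n :> R by rewrite exprn_gt0.
rewrite -ler_pdivrMr // mulrAC.
apply: le_trans (_ : _ <= (1 + x) ^+ (g + \sum_j a j)) _; last first.
  by rewrite ler_weXn2l // leq_add2l.
apply: golden_clear hx e _.
by rewrite mulrAC ler_pdivrMr.
Qed.

(* Semigroups of multiplicity m without gaps from 2 m + k on. *)
Definition multFam g m k : {set {set 'I_(2 * g).+1}} :=
  [set A in SG g | `[< [/\ ext A m, forall n, (0 < n < m)%N -> ~~ ext A n &
     forall n, (2 * m + k <= n)%N -> ext A n] >]].

(** Each of the points 1, ..., m - 1 is a gap, and each of the next m + k points weighs at most 1 +
    y. The weight y stays free so that it can be tilted away from 1/phi. *)
Lemma card_multFam (R : realFieldType) (y : R) g m k :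
  0 < y <= 1 -> (0 < m)%N ->
  #|multFam g m k|%:R * y ^+ g <= y ^+ m.-1 * (1 + y) ^+ (m + k).
Proof.
move=> /andP[y0 y1] m0; set Fam := multFam _ _ _.
have FamP A : A \in Fam -> A \in SG g /\ [/\ ext A m, forall n, (0 < n < m)%N -> ~~ ext A n &
     forall n, (2 * m + k <= n)%N -> ext A n].
  by rewrite inE => /andP[hA /asboolP].
have -> : y ^+ m.-1 * (1 + y) ^+ (m + k) =
    \prod_(j < 2 * m + k) (y ^+ (1 <= j < m) * (1 + y) ^+ (m <= j < 2 * m + k)).
  by rewrite big_split /= !prodrXr !sum_interval; congr (_ ^+ _ * _ ^+ _); clear; lia.
refine (@cell_bound R _ _ Fam (fun A (j : 'I_(2 * m + k)) => (ext A j, true))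
    (fun j q => q.2 && ((j < m)%N ==> (q.1 == (j == 0%N :> nat)))) y g
    (fun j => (y ^+ (1 <= j < m)%N * (1 + y) ^+ (m <= j < 2 * m + k)%N)) _ _ _ _ _).
- by rewrite ltW.
- move=> A A' /FamP[_ [_ _ hF]] /FamP[_ [_ _ hF']] eA; apply: ext_inj => i.
  case: (leqP (2 * m + k) i) => iF; first by rewrite hF ?hF'.
  by have [] := eA (Ordinal iF).
- move=> A /FamP[/in_SG[A0 _ _] [_ low _]] j /=; apply/implyP => jm.
  case: (posnP j) => [->|j0]; first by rewrite A0.
  by rewrite (negbTE (low _ _)) ?j0 // eqn0Ngt j0.
- move=> A /FamP[/in_SG[_ _ hg] _].
  rewrite -[leqRHS]hg; apply: leq_trans (sum_gaps_le A (2 * m + k)).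
  by apply: leq_sum => j _; rewrite addn0.
- move=> j; rewrite big_mkcond sum_bool_pair /= ltn_ord andbT.
  case: (posnP j) => [->|j0]; first by rewrite m0 /= leqNgt m0 /= !expr0; lra.
  case: (leqP m j) => jm /=; rewrite ?expr0 ?expr1 ?mul1r ?mulr1; lra.
Qed.

(** * Exponential estimates *)

(** The exponential-moment bound for binomial sums; the elements of B play the role of the gaps in
    [cell_bound]. *)
Lemma card_small_subsets (R : realFieldType) (z : R) N k :
  0 < z <= 1 -> #|[set B : {set 'I_N} | (#|B| <= k)%N]|%:R * z ^+ k <= (1 + z) ^+ N.
Proof.
move=> /andP[z0 z1]; rewrite -[X in (1 + z) ^+ X]card_ord -prodr_const.
refine (@cell_bound R _ _ _ (fun (B : {set 'I_N}) j => (j \notin B, true))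
  (fun j q => q.2) z k (fun=> 1 + z) _ _ _ _ _).
- by rewrite ltW.
- by move=> B B' _ _ e; apply/setP => j; have [] := e j; do 2 case: (j \in _).
- by move=> B _ j.
- move=> B; rewrite inE; apply: leq_trans; rewrite -sum1_card [leqRHS]big_mkcond.
  by apply: leq_sum => j _; rewrite negbK addn0; case: (j \in B).
- by move=> j; rewrite big_mkcond sum_bool_pair /= expr0 expr1 !addr0.
Qed.

Lemma expR_ge1D_exp (R : realType) (z : R) n : 0 <= z -> (1 + z) ^+ n <= expR (z * n%:R).
Proof.
move=> z0; rewrite expRM_natr; apply: lerXn2r; rewrite ?nnegrE ?expR_ge0 ?addr_ge0 //.
exact: expR_ge1Dx.
Qed.

(** Half of the exponent pays for (1 + z)^N, since z is at most eta / 2. The other half pays for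
    z^-k, since k is at most N / h and [h0] is chosen after z. *)
Lemma card_small_subsets_exp (R : realType) (eta : R) : 0 < eta ->
  exists2 h0 : nat, (0 < h0)%N & forall h N k, (h0 <= h)%N -> (h * k <= N)%N ->
    #|[set B : {set 'I_N} | (#|B| <= k)%N]|%:R <= expR (eta * N%:R).
Proof.
move=> eta0; pose z := Num.min (eta / 2) 1.
have z0 : 0 < z by rewrite lt_min divr_gt0 //=.
have z1 : z <= 1 by rewrite ge_min lexx orbT.
have zeta : z <= eta / 2 by rewrite ge_min lexx.
pose h0 := (Num.truncn (- ln z * 2 / eta)).+1.
have lnz : 0 <= - ln z by rewrite oppr_ge0 ln_le0.
have h0P : - ln z * 2 / eta <= h0%:R by rewrite ltW // truncnS_gt.
exists h0 => // h N k hh hk; rewrite -(ler_pM2r (exprn_gt0 k z0)).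
apply: le_trans (card_small_subsets _ _ _) _; first by rewrite z0.
apply: le_trans (expR_ge1D_exp N (ltW z0)) _.
rewrite -[z in z ^+ k]lnK ?posrE // -expRM_natr -expRD ler_expR -lerBlDr.
have hk' : - ln z * k%:R <= eta / 2 * N%:R.
  apply: le_trans (_ : eta / 2 * (h0%:R * k%:R) <= _); last first.
    by rewrite ler_pM2l ?divr_gt0 // -natrM ler_nat (leq_trans _ hk) // leq_mul2r hh orbT.
  rewrite mulrA ler_wpM2r // -(ler_pM2l (_ : 0 < 2 / eta)) ?divr_gt0 //.
  rewrite (_ : 2 / eta * (eta / 2 * h0%:R) = h0%:R); last by field; rewrite gt_eqF.
  by apply: le_trans h0P; rewrite mulrC mulrA.
have : z * N%:R <= eta / 2 * N%:R by rewrite ler_wpM2r.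
by move: hk'; lra.
Qed.

Lemma sum_mem_le (T P : finType) (X : {set T}) (Y : P -> {set T}) (D : {set P}) :
  (\sum_(A in X) \sum_(p in D) (A \in Y p) <= \sum_(p in D) #|Y p|)%N.
Proof.
rewrite exchange_big; apply: leq_sum => p _ /=; rewrite -sum1_card big_mkcond [leqRHS]big_mkcond.
by apply: leq_sum => A _; case: (A \in X); case: (A \in Y p).
Qed.

Lemma card_cover2 (R : numDomainType) (T P Q : finType) (X : {set T})
    (Y : P -> {set T}) (Z : Q -> {set T}) (D : {set P}) (E : {set Q}) (c d : R) :
  {in X, forall A, (exists2 p, p \in D & A \in Y p) \/ (exists2 q, q \in E & A \in Z q)} ->
  {in D, forall p, #|Y p|%:R <= c} -> {in E, forall q, #|Z q|%:R <= d} ->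
  #|X|%:R <= #|D|%:R * c + #|E|%:R * d.
Proof.
move=> cov hY hZ.
have h : (#|X| <= \sum_(p in D) #|Y p| + \sum_(q in E) #|Z q|)%N.
  apply: leq_trans (leq_add (sum_mem_le X Y D) (sum_mem_le X Z E)).
  rewrite -sum1_card -big_split; apply: leq_sum => A /cov[] [p hp hA] /=.
    by rewrite (bigD1 p) //= hA.
  by rewrite addnC (bigD1 p) //= hA.
apply: (@le_trans _ _ (\sum_(p in D) #|Y p| + \sum_(q in E) #|Z q|)%N%:R); first by rewrite ler_nat.
rewrite natrD !natr_sum !mulr_natl -!sumr_const.
by apply: lerD; apply: ler_sum => p hp; [apply: hY|apply: hZ].
Qed.

(** * Semigroups with a gap far beyond twice the multiplicity *)

Lemma card_bounded N (X : {set 'I_N}) F :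
  (F <= N)%N -> {in X, forall i : 'I_N, (i < F)%N} -> (#|X| <= F)%N.
Proof.
move=> FN hX; rewrite -(sum_ext_eq FN hX) -[leqRHS]card_ord -sum1_card.
by apply: leq_sum => j _; case: ext.
Qed.

(** Any nonzero member m may witness this; the condition is weakest for the least one, so it
    concerns the multiplicity. *)
Definition farGap g k : {set {set 'I_(2 * g).+1}} :=
  [set A in SG g | `[< exists m F, [/\ (0 < m)%N, ext A m, ~~ ext A F & (2 * m + k <= F)%N] >]].

(** The fingerprints that occur. The sizes of B and S0 keep their number at a small exponential
    rate, and e is the margin between 2 b and F. *)
Definition containerDom g e h (q : 'I_(2 * g).+1 * 'I_(2 * g).+1 * {set 'I_(2 * g).+1} * {set 'I_(2 * g).+1}) : Prop :=
  let: (F, b, B, S0) := q in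
  [/\ (2 * b + e <= F)%N, #|B| = (h ^ 2)%N, {in B, forall t : 'I__, (t <= b)%N},
    {in S0, forall s : 'I__, (b < s)%N /\ (s + b < F)%N} & (h * #|S0| <= 2 * g)%N].

Definition sparseDom g e h n (q : 'I_(2 * g).+1 * 'I_(2 * g).+1 * {set 'I_(2 * g).+1}) : Prop :=
  let: (F, t, B) := q in
  [/\ (#|B| <= h ^ 2)%N, (e <= F)%N, (n <= t)%N & ((F - e)./2 + n + t <= F)%N].

Definition initial g (A : {set 'I_(2 * g).+1}) (b : nat) : {set 'I_(2 * g).+1} :=
  [set i in A | (0 < i <= b)%N].

Lemma ext_initial g (A : {set 'I_(2 * g).+1}) b n : A \in SG g -> (b <= 2 * g)%N -> (n <= b)%N ->
  ext A n = (n == 0%N) || ext (initial A b) n.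
Proof.
move=> /in_SG[A0 _ _] bg nb; have nN : (n < (2 * g).+1)%N by lia.
rewrite !(ext_ord _ (Ordinal nN)) inE /= nb andbT -ext_ord /=.
by case: posnP => [->|_] /=; rewrite ?A0 ?andbT.
Qed.

Lemma initial_step g (A : {set 'I_(2 * g).+1}) b :
  (#|initial A b.+1| <= #|initial A b|.+1)%N.
Proof.
apply: (@leq_trans #|inord b.+1 |: initial A b|); last by rewrite cardsU1 -[leqRHS]add1n leq_add2r leq_b1.
apply/subset_leq_card/subsetP => i; rewrite !inE => /andP[-> /andP[i0 ib]].
rewrite i0 /=; case: (leqP i b) => ib'; rewrite ?orbT // orbF; apply/eqP/val_inj.
have e : i = b.+1 :> nat by lia.
by rewrite /= -e inord_val.
Qed.

Lemma initial_reach g (A : {set 'I_(2 * g).+1}) p d :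
  (d <= #|initial A p|)%N -> exists2 b, (b <= p)%N & #|initial A b| = d.
Proof.
elim: p => [|p IH] hd.
  have e : initial A 0 = set0 by apply/setP => i; rewrite !inE leqn0 lt0n andNb andbF.
  by exists 0%N => //; move: hd; rewrite e cards0; lia.
case: (leqP d #|initial A p|) => [/IH[b bp hb]|lt_d]; first by exists b => //; rewrite leqW.
by exists p.+1 => //; have := initial_step A p; lia.
Qed.

Lemma sg_mul N g (A : {set 'I_N}) q m : is_sg g A -> ext A m -> ext A (q * m).
Proof. by move=> [A0 add _] hm; elim: q => [|q IH] //; rewrite mulSn add. Qed.

(** If m < n, the first multiple of m beyond n is at most n + m, hence below 2 n. *)
Lemma sg_element N g (A : {set 'I_N}) n m : is_sg g A -> ext A m -> (0 < m)%N ->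
  exists2 t, ext A t & (n <= t)%N /\ ((t <= m)%N || (t <= 2 * n)%N).
Proof.
move=> sA hm m0; case: (leqP n m) => nm; first by exists m => //; rewrite leqnn.
exists ((n %/ m).+1 * m)%N; first exact: sg_mul sA hm.
have := ltn_ceil n m0; have := leq_trunc_div n m; rewrite mulSn; move: (n %/ m * m)%N; lia.
Qed.

Lemma sg_frobenius g (A : {set 'I_(2 * g).+1}) F' : ~~ ext A F' ->
  exists F, [/\ (F < (2 * g).+1)%N, (F' <= F)%N, ~~ ext A F & forall n, (F < n)%N -> ext A n].
Proof.
move=> hF'; have ex : exists i, ~~ ext A i by exists F'.
have bd i : ~~ ext A i -> (i <= 2 * g)%N by move=> /ext_gap.
have [F hF hmax] := ex_maxnP ex bd; exists F; split; rewrite ?ltnS ?bd ?hmax //.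
by move=> n Fn; apply: contraLR Fn => /hmax; rewrite -leqNgt.
Qed.

(** The dichotomy is whether A has at least h^2 nonzero members up to p = (F - e) / 2. If so, the
    first h^2 of them form B; if not, the segment up to p is sparse and a single shift t is used. *)
Lemma farGap_cases g k e n h A : (0 < h)%N -> (e <= k)%N -> (6 * n <= k)%N -> A \in farGap g k ->
  (exists2 q, containerDom e h q & let: (F, b, B, S0) := q in A \in containerFam F b h B S0)
  \/ (exists2 q, sparseDom e h n q & let: (F, t, B) := q in A \in sparseFam F (F - e)./2 t B).
Proof.
move=> h0 ek nk; rewrite inE => /andP[SA /asboolP[m [F' [m0 Am gapF' mF']]]].
have sA := in_SG SA; have [F [FN FF' gapF Fmax]] := sg_frobenius gapF'.
set p := (F - e)./2; have p2 : (2 * p <= F - e)%N by rewrite /p; clear; lia.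
have pF : (p <= 2 * g)%N by move: p2 FN; clear; lia.
case: (leqP (h ^ 2)%N #|initial A p|) => hp.
  left; have [b bp cB] := initial_reach hp; have bN : (b < (2 * g).+1)%N by rewrite ltnS (leq_trans bp).
  have hB : {in initial A b, forall t : 'I__, (t <= b)%N} by move=> t; rewrite inE => /and3P[].
  have Fg : (F <= 2 * g)%N by [].
  have [S0 [S0P cS0 S0D]] := container_exists A h0 Fg hB.
  exists (Ordinal FN, Ordinal bN, initial A b, S0).
    split=> //=.
    - by move: bp p2 mF' FF' ek; clear; lia.
    - by move=> s /S0P[].
    - apply: leq_trans cS0 _; apply: leq_trans (card_bounded _ _) Fg; first exact: ltnW.
      by move=> i /sumsetP[s /S0P[_ _ sF] [t /hB tb ->]]; move: sF tb; clear; lia.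
  rewrite inE SA; apply/asboolP; split=> //.
  - by move=> i ib; apply: ext_initial => //; move: bN; clear; lia.
  - by apply/subsetP => s /S0P[].
(* The bound [6 * n <= k] makes room for the pairs: p is at most F / 2, and n + t is at most F / 2
   whether t <= m, where m is at most (F - k) / 2, or t <= 2 n. *)
right; have [t At [nt tm]] := sg_element n sA Am m0.
have tN : (t < (2 * g).+1)%N by move: tm mF' FF' FN nk; clear; lia.
exists (Ordinal FN, Ordinal tN, initial A p).
  by split=> //=; rewrite -/p; [exact: ltnW|move: tm p2 mF' FF' FN nk ek; clear; lia..].
rewrite inE SA; apply/asboolP; split=> // i ip.
exact: ext_initial.
Qed.

Definition lnphi (R : realType) : R := ln (phi R).

Lemma phi_gt1 (R : realType) : 1 < phi R.
Proof. by have /andP[+ _] := phi_bounds R; apply: lt_trans; rewrite ltr_pdivlMr // mul1r ltr_nat. Qed.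

Lemma lnphi_gt0 (R : realType) : 0 < lnphi R.
Proof. by rewrite ln_gt0 // phi_gt1. Qed.

Lemma phiX (R : realType) n : phi R ^+ n = expR (lnphi R * n%:R).
Proof. by rewrite expRM_natr lnK // posrE (lt_trans ltr01) // phi_gt1. Qed.

Lemma invphi_itv (R : realType) : 0 < invphi R < 1.
Proof.
have /andP[lo hi] := invphi_bounds R.
by rewrite (lt_trans _ lo) ?divr_gt0 //= (lt_trans hi) // ltr_pdivrMr // mul1r ltr_nat.
Qed.

(* ln (phi^2 / 2), gained at each pair (j, j + t). *)
Definition sparse_gain (R : realType) : R := 2 * lnphi R - ln 2.

Lemma sparse_gain_gt0 (R : realType) : 0 < sparse_gain R.
Proof.
have p1 := phi_gt1 R; have p0 : 0 < phi R by rewrite (lt_trans ltr01).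
rewrite subr_gt0 /lnphi mulr_natl -lnXn // ltr_ln ?posrE ?exprn_gt0 //.
have -> : phi R ^+ 2 = 1 + phi R.
  by rewrite phiE; have := invphi_sq R; move: (invphi R) => x e;
    rewrite sqrrD expr1n mul1r (_ : x ^+ 2 = 1 - x) -?e ?addrK; [ring|rewrite addrC addKr].
by rewrite -[2]/(1 + 1) ltrD2l.
Qed.

Lemma le_expR_div (R : realType) (y : R) a b :
  y * phi R ^+ b <= phi R ^+ a -> y <= expR (lnphi R * (a%:R - b%:R)).
Proof.
by rewrite mulrBr expRD expRN -!phiX ler_pdivlMr // exprn_gt0 // (lt_trans ltr01) // phi_gt1.
Qed.

(** The containers enter only through D - N0, which is at most 2 g / h; the gain e / 2 comes from
    the u cells beyond b. *)
Lemma container_arith (R : realFieldType) (g h h2 e D N0 u : R) :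
  0 < h -> h * D <= h * N0 + 2 * g -> e <= 2 * u + 2 ->
  (g + (h2 + 1 + D)) - (N0 + u) <= g + h2 + 2 + 2 * g / h - e / 2.
Proof.
move=> h0 hD hu.
have : D <= N0 + 2 * g / h by rewrite -(ler_pM2l h0) mulrDr [h * (_ / h)]mulrC divfK ?gt_eqF.
lra.
Qed.

Lemma containerFam_exp (R : realType) g e h (q : 'I_(2 * g).+1 * 'I_(2 * g).+1 *
    {set 'I_(2 * g).+1} * {set 'I_(2 * g).+1}) :
  (0 < h)%N -> (0 < e)%N -> containerDom e h q ->
  (let: (F, b, B, S0) := q in #|containerFam F b h B S0|)%:R <=
    expR (lnphi R * (g%:R + h%:R ^+ 2 + 2 + 2 * g%:R / h%:R - e%:R / 2)).
Proof.
case: q => [[[F b] B] S0] h0 e0 [Fb cB hB hS0 cS0].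
have bF : (2 * b < F)%N by move: Fb e0; clear; lia.
have := card_containerFam h (invphi_itv R) (invphi_sq R) bF (ltn_ord F) hB hS0.
rewrite -phiE => /le_expR_div /le_trans; apply; rewrite ler_expR ler_pM2l ?lnphi_gt0 //.
rewrite !natrD -(natr1 #|B|) cB natrX; apply: container_arith; first by rewrite ltr0n.
  rewrite -!natrM -natrD ler_nat; apply: leq_trans (container_card _ h0 hB cB (ltn_ord F)) _.
  by rewrite leq_add2l -ltnS.
rewrite -natrM -natrD ler_nat; move: Fb; have := uphalf_half F; clear; lia.
Qed.

(** Here v is the length of the prescribed segment and u the number of remaining single points. As v
    is about (F - e) / 2, they balance up to e, and each of the n pairs contributes 2 instead of
    phi^2. *)
Lemma sparse_arith (R : realFieldType) (g b h2 e u v n L l2 : R) :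
  0 <= L -> b <= h2 -> u - v <= e - 2 * n -> 
  L * ((g + (b + 1 + u)) - (v + 1)) + l2 * n <= L * (g + h2 + e) - (2 * L - l2) * n.
Proof. 
move=> L0 hb huv.
have : L * ((g + (b + 1 + u)) - (v + 1)) <= L * (g + h2 + (e - 2 * n)).
  by rewrite ler_wpM2l //; lra.
lra.
Qed.

Lemma sparseFam_exp (R : realType) g e h n (q : 'I_(2 * g).+1 * 'I_(2 * g).+1 *
    {set 'I_(2 * g).+1}) :
  sparseDom e h n q ->
  (let: (F, t, B) := q in #|sparseFam F (F - e)./2 t B|)%:R <=
    expR (lnphi R * (g%:R + h%:R ^+ 2 + e.+1%:R) - sparse_gain R * n%:R).
Proof.
case: q => [[F t] B] [cB eF nt pF].
have := card_sparseFam B (invphi_itv R) (invphi_sq R) (ltn_ord F) nt pF.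
rewrite -phiE -ler_pdivrMr ?exprn_gt0 // mulrAC => /le_expR_div.
rewrite ler_pdivrMr ?exprn_gt0 // -[X in _ * X ^+ n]lnK ?posrE // -expRM_natr -expRD => /le_trans.
apply; rewrite ler_expR !natrD -(natr1 #|B|) -(natr1 (_./2)).
apply: sparse_arith; [exact/ltW/lnphi_gt0| |]; first by rewrite -natrX ler_nat.
rewrite lerBlDr addrAC lerBrDr -natrM -!natrD ler_nat; move: eF pF nt; clear; lia.
Qed.

Lemma eventually_le (R : realType) (C c : R) : 0 < c ->
  exists g0 : nat, forall g, (g0 <= g)%N -> C <= c * g%:R.
Proof.
move=> c0; exists (Num.truncn (C / c)).+1 => g hg.
rewrite -ler_pdivrMl // mulrC; apply: le_trans (ltW (truncnS_gt (C / c))) _.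
by rewrite ler_nat.
Qed.

(** The exponential exceeds the cube of c g / 3, while 2 g + 1 <= 3 g bounds the left side by 18
    g^2. *)
Lemma eventually_poly (R : realType) (c : R) : 0 < c ->
  exists g0 : nat, forall g, (g0 <= g)%N -> 2 * ((2 * g).+1 ^ 2)%:R <= expR (c * g%:R).
Proof.
move=> c0; have c3 : 0 < (c / 3) ^+ 3 by rewrite exprn_gt0 // divr_gt0.
have [g0 hg0] := eventually_le 18 c3; exists g0.+1 => g hg.
have -> : c * g%:R = (c / 3 * g%:R) *+ 3 by rewrite -mulrnAl -[(c / 3) *+ 3]mulr_natr divfK ?pnatr_eq0.
rewrite -[X in expR X]mulr_natr expRM_natr.
apply: (@le_trans _ _ ((c / 3 * g%:R) ^+ 3)); last first.
  have z0 : 0 <= c / 3 * g%:R by apply: mulr_ge0 => //; apply: divr_ge0 => //; apply: ltW.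
  apply: lerXn2r; rewrite ?nnegrE ?expR_ge0 //.
  by apply: le_trans (expR_ge1Dx (c / 3 * g%:R)); rewrite lerDr.
rewrite exprMn [g%:R ^+ 3]exprS mulrA; apply: (@le_trans _ _ (18 * g%:R ^+ 2)).
  by rewrite -natrM -!natrX -natrM ler_nat; move: hg; clear; nia.
by apply: ler_wpM2r; [exact: exprn_ge0|exact/hg0/ltnW].
Qed.

Definition small_sets N k : {set {set 'I_N}} := [set B : {set 'I_N} | (#|B| <= k)%N].

(** The condition on h^3 puts B, which has h^2 elements, into the same class of small sets as S0. *)
Lemma card_containerDom g e h : (h ^ 3 <= 2 * g)%N -> (0 < h)%N ->
  (#|[set q | `[< @containerDom g e h q >]]| <=
     (2 * g).+1 ^ 2 * #|small_sets (2 * g).+1 (2 * g %/ h)| ^ 2)%N.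
Proof.
move=> hg h0; set s := small_sets _ _.
apply: (@leq_trans #|setX (setX (setX [set: 'I_(2 * g).+1] [set: 'I_(2 * g).+1]) s) s|); last first.
  by rewrite !cardsX cardsT card_ord mulnA !mulnn -mulnA mulnn.
apply/subset_leq_card/subsetP => -[[[F b] B] S0]; rewrite !inE => /asboolP[_ cB _ _ cS].
by rewrite /= cB !leq_divRL // -expnSr hg mulnC cS.
Qed.

Lemma card_sparseDom g e h n : (h ^ 3 <= 2 * g)%N -> (0 < h)%N ->
  (#|[set q | `[< @sparseDom g e h n q >]]| <=
     (2 * g).+1 ^ 2 * #|small_sets (2 * g).+1 (2 * g %/ h)|)%N.
Proof.
move=> hg h0; set s := small_sets _ _.
apply: (@leq_trans #|setX (setX [set: 'I_(2 * g).+1] [set: 'I_(2 * g).+1]) s|); last first.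
  by rewrite !cardsX cardsT card_ord mulnn.
apply/subset_leq_card/subsetP => -[[F t] B]; rewrite !inE => /asboolP[cB _ _ _].
by rewrite /= leq_divRL // (leq_trans _ hg) // [(h ^ 3)%N]expnSr leq_mul2r cB orbT.
Qed.

Lemma card_farGap_le (R : realType) (s : R) g k e n h :
  (0 < h)%N -> (0 < e)%N -> (e <= k)%N -> (6 * n <= k)%N -> (h ^ 3 <= 2 * g)%N ->
  #|small_sets (2 * g).+1 (2 * g %/ h)|%:R <= expR s ->
  #|farGap g k|%:R <= ((2 * g).+1 ^ 2)%:R *
    (expR (2 * s + lnphi R * (g%:R + h%:R ^+ 2 + 2 + 2 * g%:R / h%:R - e%:R / 2)) +
     expR (s + (lnphi R * (g%:R + h%:R ^+ 2 + e.+1%:R) - sparse_gain R * n%:R))).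
Proof.
move=> h0 e0 ek nk hg hs.
set c := lnphi R * (_ + 2 + _ - _); set d := lnphi R * _ - _.
apply: (@le_trans _ _ (#|[set q | `[< @containerDom g e h q >]]|%:R * expR c +
   #|[set q | `[< @sparseDom g e h n q >]]|%:R * expR d)).
  pose Y (q : 'I_(2 * g).+1 * 'I_(2 * g).+1 * {set 'I_(2 * g).+1} * {set 'I_(2 * g).+1}) :=
    let: (F, b, B, S0) := q in containerFam F b h B S0.
  pose Z (q : 'I_(2 * g).+1 * 'I_(2 * g).+1 * {set 'I_(2 * g).+1}) :=
    let: (F, t, B) := q in sparseFam F (F - e)./2 t B.
  apply: (@card_cover2 R _ _ _ (farGap g k) Y Z); rewrite /Y /Z.
  - move=> A hA; case: (farGap_cases h0 ek nk hA) => -[q hq hAq]; [left|right].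
      by exists q; [rewrite inE; apply/asboolP|case: q {hq} hAq => [[[]]]].
    by exists q; [rewrite inE; apply/asboolP|case: q {hq} hAq => [[]]].
  - move=> [[[F b] B] S0]; rewrite inE => /asboolP hq; exact: (@containerFam_exp R _ _ _ _ h0 e0 hq).
  - move=> [[F t] B]; rewrite inE => /asboolP hq; exact: (@sparseFam_exp R _ _ _ _ _ hq).
rewrite mulrDr; apply: lerD.
  rewrite expRD mulrA ler_wpM2r ?expR_ge0 //.
  apply: (@le_trans _ _ ((2 * g).+1 ^ 2 * #|small_sets (2 * g).+1 (2 * g %/ h)| ^ 2)%:R).
    by rewrite ler_nat card_containerDom.
  rewrite natrM ler_wpM2l // natrX mulrC expRM_natr.
  by apply: lerXn2r; rewrite ?nnegrE ?expR_ge0.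
rewrite expRD mulrA ler_wpM2r ?expR_ge0 //.
apply: (@le_trans _ _ ((2 * g).+1 ^ 2 * #|small_sets (2 * g).+1 (2 * g %/ h)|)%:R).
  by rewrite ler_nat card_sparseDom.
by rewrite natrM ler_wpM2l.
Qed.

(** In units of L eps g / 8, the gain L e / 2 is worth 4 up to a constant. The number of
    fingerprints, the term 2 g / h and the constants cost 1 each, so 1 remains. *)
Lemma farGap_arith1 (R : realFieldType) (L g h e eps eta : R) :
  0 < L -> 0 <= g -> 0 < h -> 16 <= h * eps -> 48 * eta <= L * eps -> eps * g <= e + 1 -> 
  L * (h ^+ 2 + 3) <= L * eps / 8 * g ->
  2 * (eta * (3 * g)) + L * (g + h ^+ 2 + 2 + 2 * g / h - e / 2) <= L * g - L * eps / 8 * g.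
Proof.
move=> L0 g0 h0 hh heta he hK.
have i1 : 2 * g / h <= eps / 8 * g by rewrite ler_pdivrMr //; nra.
have i2 : L * (2 * g / h) <= L * (eps / 8 * g) by rewrite ler_wpM2l // ltW.
have i3 : 48 * eta * g <= L * eps * g by rewrite ler_wpM2r.
have i4 : L * (eps * g) <= L * (e + 1) by rewrite ler_wpM2l // ltW.
lra.
Qed.

(** In units of ka de g / 24, the gain ka n is worth 4 up to a constant; the number of prescribed
    segments, the loss L e and the constants cost 1 each. *)
Lemma farGap_arith2 (R : realFieldType) (L g h e eps eta ka de n : R) :
  0 < L -> 0 <= g -> 0 < ka -> 72 * eta <= ka * de -> e <= eps * g -> 24 * L * eps <= ka * de ->
  de * g <= 6 * (n + 1) -> L * (h ^+ 2 + 1) + ka <= ka * de / 24 * g ->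
  eta * (3 * g) + (L * (g + h ^+ 2 + (e + 1)) - ka * n) <= L * g - ka * de / 24 * g.
Proof.
move=> L0 g0 k0 heta he heps hn hK.
have i1 : L * e <= L * (eps * g) by rewrite ler_wpM2l // ltW.
have i2 : 24 * L * eps * g <= ka * de * g by rewrite ler_wpM2r.
have i3 : 72 * eta * g <= ka * de * g by rewrite ler_wpM2r.
have i4 : ka * (de * g) <= ka * (6 * (n + 1)) by rewrite ler_wpM2l // ltW.
lra.
Qed.

Lemma card_farGap_small (R : realType) (delta : R) : 0 < delta ->
  exists2 c : R, 0 < c & exists g0 : nat, forall g k, (g0 <= g)%N -> delta * g%:R <= k%:R ->
    #|farGap g k|%:R <= expR ((lnphi R - c) * g%:R).
Proof.
move=> d0; have L0 := lnphi_gt0 R; have ka0 := sparse_gain_gt0 R.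
set L := lnphi R in L0 *; set ka := sparse_gain R in ka0 *.
(* The choices are made in the order [eps], [eta], [h], g. Here [eps <= delta] gives e <= k, and the
   second bound keeps the loss L e of the sparse case below its gain. *)
pose eps := Num.min delta (ka * delta / (24 * L)).
have eps0 : 0 < eps by rewrite lt_min d0 divr_gt0 // mulr_gt0.
have eps_d : eps <= delta by rewrite ge_min lexx.
have eps_k : 24 * L * eps <= ka * delta.
  by rewrite mulrC -ler_pdivlMr ?mulr_gt0 // ge_min lexx orbT.
pose eta := Num.min (L * eps / 48) (ka * delta / 72).
have eta0 : 0 < eta by rewrite lt_min !divr_gt0 ?mulr_gt0.
have eta1 : 48 * eta <= L * eps by rewrite mulrC -ler_pdivlMr // ge_min lexx.
have eta2 : 72 * eta <= ka * delta by rewrite mulrC -ler_pdivlMr // ge_min lexx orbT.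
have [h1 h1_gt0 h1P] := card_small_subsets_exp eta0.
pose h := maxn h1 (Num.truncn (16 / eps)).+1.
have h_gt0 : (0 < h)%N by rewrite leq_max h1_gt0.
have h_eps : 16 <= h%:R * eps.
  rewrite -ler_pdivrMr //; apply: le_trans (ltW (truncnS_gt _)) _.
  by rewrite ler_nat leq_max leqnn orbT.
pose c' := Num.min (L * eps / 8) (ka * delta / 24).
have c'0 : 0 < c' by rewrite lt_min !divr_gt0 ?mulr_gt0.
have c1 : 0 < L * eps / 8 by rewrite divr_gt0 ?mulr_gt0.
have c2 : 0 < ka * delta / 24 by rewrite divr_gt0 ?mulr_gt0.
have c'2 : 0 < c' / 2 by rewrite divr_gt0.
exists (c' / 2) => //.
have [g1 g1P] := eventually_le 1 eps0.
have [g2 g2P] := eventually_le (L * (h%:R ^+ 2 + 3)) c1.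
have [g3 g3P] := eventually_le (L * (h%:R ^+ 2 + 1) + ka) c2.
have [g4 g4P] := eventually_poly c'2.
exists (g1 + g2 + g3 + g4 + h ^ 3 + 1)%N => g k hg hk.
have [hg1 hg2 hg3 hg4 hg5] : [/\ (g1 <= g)%N, (g2 <= g)%N, (g3 <= g)%N, (g4 <= g)%N &
    (h ^ 3 <= 2 * g)%N /\ (0 < g)%N].
  by move: hg; move: (h ^ 3)%N; clear; split; [..|split]; lia.
have [hg6 g_gt0] := hg5.
pose e := Num.truncn (eps * g%:R); pose n := Num.truncn (delta * g%:R / 6).
have eg0 : 0 <= eps * g%:R by rewrite mulr_ge0 // ltW.
have dg0 : 0 <= delta * g%:R / 6 by rewrite divr_ge0 // mulr_ge0 // ltW.
have e_le : e%:R <= eps * g%:R by rewrite truncn_le.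
have e_gt : eps * g%:R <= e%:R + 1 by rewrite natr1 ltW // truncnS_gt.
have n_gt : delta * g%:R <= 6 * (n%:R + 1).
  by rewrite natr1 [6 * _]mulrC -ler_pdivrMr // ltW // truncnS_gt.
have e_gt0 : (0 < e)%N by rewrite truncn_gt0 g1P.
have ek : (e <= k)%N.
  by rewrite -(ler_nat R); apply: le_trans hk; apply: le_trans e_le _; rewrite ler_wpM2r.
have nk : (6 * n <= k)%N.
  rewrite -(ler_nat R); apply: le_trans hk; rewrite natrM [6 * _]mulrC -ler_pdivlMr //.
  by rewrite truncn_le.
have hsmall : #|small_sets (2 * g).+1 (2 * g %/ h)|%:R <= expR (eta * (3 * g%:R)).
  apply: le_trans (h1P h (2 * g).+1 (2 * g %/ h)%N _ _) _; first by rewrite leq_max leqnn.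
    by rewrite mulnC (leq_trans (leq_trunc_div _ _)).
  by rewrite ler_expR ler_pM2l // -natrM ler_nat; move: g_gt0; clear; lia.
apply: le_trans (card_farGap_le h_gt0 e_gt0 ek nk hg6 hsmall) _.
(* Half of the saving absorbs the polynomial factor (2 g + 1)^2 and the factor 2 from adding the two
   cases. *)
have -> : (L - c' / 2) * g%:R = c' / 2 * g%:R + (L * g%:R - c' * g%:R) by field.
rewrite [leRHS]expRD; apply: le_trans (ler_wpM2r (expR_ge0 _) (g4P _ hg4)).
rewrite [X in _ <= X * _]mulrC -[leRHS]mulrA; apply: ler_wpM2l => //; rewrite [leRHS]mulrDl mul1r.
have g0R : 0 <= g%:R :> R by [].
have h0R : 0 < h%:R :> R by rewrite ltr0n.
apply: lerD; rewrite ler_expR.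
  apply: le_trans (farGap_arith1 L0 g0R h0R h_eps eta1 e_gt (g2P _ hg2)) _.
  by rewrite lerD2l lerN2 ler_wpM2r // ge_min lexx.
rewrite -(natr1 e).
apply: le_trans (farGap_arith2 L0 g0R ka0 eta2 e_le eps_k n_gt (g3P _ hg3)) _.
by rewrite lerD2l lerN2 ler_wpM2r // ge_min lexx orbT.
Qed.

(** * Concentration of the multiplicity *)

Lemma gamma_inv (R : realType) : gamma R * (1 + invphi R ^+ 2) = 1.
Proof.
have -> : 1 + invphi R ^+ 2 = (5 - Num.sqrt 5) / 2.
  rewrite (_ : invphi R ^+ 2 = 1 - invphi R); first by rewrite /invphi; field.
  by rewrite -(invphi_sq R) addrC addKr.
have e := sqrt5_sq R; rewrite /gamma; move: (Num.sqrt 5) e => s e.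
have -> : (5 + s) / 10 * ((5 - s) / 2) = (25 - s * s) / 20 by field.
by rewrite e; field.
Qed.

(** Second-order bounds at y = x, where x (1 + x) = 1; the derivative of y (1 + y) with respect to
    th at 0 is x + 2 x^2 = 1 + x^2. *)
Lemma chernoff_base (R : realFieldType) (x th y : R) :
  0 < x < 1 -> x + x ^+ 2 = 1 -> -1 <= 2 * th <= 1 -> y = x * (1 + th) ->
  [/\ 0 < y <= 1, 1 <= y * (1 + x) * (1 - th + 2 * th ^+ 2) &
      y * (1 + y) <= 1 + (th * (1 + x ^+ 2) + th ^+ 2)].
Proof.
move=> /andP[x0 x1] e /andP[t1 t2] ->; have x2 : x ^+ 2 = 1 - x by rewrite -e addrC addKr.
have xx : x * (1 + x) = 1 by rewrite mulrDr mulr1 -expr2.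
split.
- apply/andP; split; first by rewrite mulr_gt0 //; lra.
  have x3 : 3 * x <= 2 by nra.
  nra.
- rewrite [x * _ * _]mulrAC xx mul1r.
  have -> : (1 + th) * (1 - th + 2 * th ^+ 2) = 1 + th ^+ 2 * (1 + 2 * th) by ring.
  by rewrite lerDl mulr_ge0 ?sqr_ge0 //; lra.
have -> : x * (1 + th) * (1 + x * (1 + th)) =
    x * (1 + x) * (1 + th) + x ^+ 2 * (1 + th) * th by ring.
rewrite xx x2; have := sqr_ge0 th; rewrite expr2 => t3; nra.
Qed.

(** With y = (1 + th) / phi, the bound of [card_multFam] becomes y^-(g + 1) (y (1 + y))^m (1 + y)^k.
    Since gamma = 1 / (1 + [invphi]^2), the terms linear in th cancel up to a bounded amount exactly
    when m is gamma g up to a bounded amount. *)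
Lemma multFam_exp (R : realType) (th : R) g m k : (0 < m)%N -> -1 <= 2 * th <= 1 ->
  #|multFam g m k|%:R <= expR ((lnphi R - th + 2 * th ^+ 2) * g.+1%:R +
     (th * (1 + invphi R ^+ 2) + th ^+ 2) * m%:R + k%:R).
Proof.
move=> m0 hth.
have [/andP[y0 y1] E1 E2] := chernoff_base (invphi_itv R) (invphi_sq R) hth erefl.
set y := invphi R * _ in y0 y1 E1 E2; set E := expR (lnphi R - th + 2 * th ^+ 2).
have yE : 1 <= y * E.
  apply: le_trans E1 _; rewrite -phiE -mulrA ler_pM2l // /E /lnphi -[X in expR X]addrA expRD lnK; last first.
    by rewrite posrE (lt_trans ltr01) ?phi_gt1.
  rewrite ler_pM2l ?(lt_trans ltr01) ?phi_gt1 // -addrA.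
  exact: expR_ge1Dx.
have y2 : 1 + y <= expR 1.
  by apply: le_trans (expR_ge1Dx 1); rewrite lerD2l.
have yy : y * (1 + y) <= expR (th * (1 + invphi R ^+ 2) + th ^+ 2).
  by apply: le_trans E2 (expR_ge1Dx _).
have hy : 0 < y <= 1 by rewrite y0.
have h := card_multFam g k hy m0.
clearbody y; have E0 : 0 <= E by apply: expR_ge0.
apply: (@le_trans _ _ (#|multFam g m k|%:R * (y * E) ^+ g.+1)).
  by rewrite ler_peMr // exprn_ege1.
rewrite exprMn exprSr mulrA mulrA -mulrA.
apply: (@le_trans _ _ (y ^+ m.-1 * (1 + y) ^+ (m + k) * (y * E ^+ g.+1))).
  by rewrite ler_wpM2r // mulr_ge0 ?exprn_ge0 // ltW.
have -> : y ^+ m.-1 * (1 + y) ^+ (m + k) * (y * E ^+ g.+1) =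
    E ^+ g.+1 * (y * (1 + y)) ^+ m * (1 + y) ^+ k.
  have ym : y ^+ m = y * y ^+ m.-1 by rewrite -exprS prednK.
  rewrite exprMn ym exprD.
  move: (E ^+ _) (y ^+ _) ((1 + y) ^+ m) ((1 + y) ^+ k) => u v w z; ring.
have y3 : 0 <= 1 + y by rewrite addr_ge0 // ltW.
rewrite 2!expRD !expRM_natr -/E; have yy0 : 0 <= y * (1 + y) by rewrite mulr_ge0 // ltW.
apply: ler_pM; [by apply: mulr_ge0; apply: exprn_ge0|exact: exprn_ge0| |].
  apply: ler_wpM2l; first exact: exprn_ge0.
  by apply: lerXn2r; rewrite ?nnegrE ?expR_ge0.
by rewrite -[k%:R]mul1r expRM_natr; apply: lerXn2r; rewrite ?nnegrE ?expR_ge0.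
Qed.

(** In units of a^2 g, the linear term gains 6; the terms in th^2 cost 2 + 1, k costs 3/2 and the
    constants 3/4, so 3/4 remains. *)
Lemma offGamma_arith (R : realFieldType) (L a s ga g m k th : R) :
  0 < a -> 6 * a <= 1 -> ga * s = 1 -> 1 <= s -> 0 <= g -> 0 <= m <= g + 1 -> k <= 3 / 2 * a ^+ 2 * g ->
  (th = - a /\ 6 * a * g <= m - ga * g) \/ (th = a /\ 6 * a * g <= ga * g - m) ->
  L + 2 <= 3 / 4 * a ^+ 2 * g ->
  (L - th + 2 * th ^+ 2) * (g + 1) + (th * s + th ^+ 2) * m + k <= (L - 3 / 4 * a ^+ 2) * g.
Proof.
move=> a0 a6 gs s1 g0 /andP[m0 m1] hk hth hL.
have a2 : a ^+ 2 <= a / 6 by nra.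
have th2 : th ^+ 2 = a ^+ 2 by case: hth => -[-> _]; rewrite ?sqrrN.
have i1 : a ^+ 2 * m <= a ^+ 2 * (g + 1) by rewrite ler_wpM2l ?sqr_ge0.
have i2 : th * s * m - th * g <= - (6 * a ^+ 2 * g).
  have e1 : th * s * m - th * g = th * (s * (m - ga * g)).
    by rewrite mulrBr [s * (ga * g)]mulrA [s * ga]mulrC gs mul1r mulrBr mulrA.
  rewrite e1; case: hth => -[-> h].
    have : 6 * a * g <= s * (m - ga * g).
      by apply: (le_trans h); rewrite ler_peMl // (le_trans _ h) // !mulr_ge0 // ltW.
    by move=> h2; have := ler_wpM2l (ltW a0) h2; rewrite expr2; lra.
  have : 6 * a * g <= s * (ga * g - m).
    by apply: (le_trans h); rewrite ler_peMl // (le_trans _ h) // !mulr_ge0 // ltW.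
  by move=> h2; have := ler_wpM2l (ltW a0) h2; rewrite expr2; lra.
have i3 : - th <= a by case: hth => -[-> _]; lra.
have -> : (L - th + 2 * th ^+ 2) * (g + 1) + (th * s + th ^+ 2) * m + k =
  L * g + (L - th + 2 * a ^+ 2) + 2 * a ^+ 2 * g + (th * s * m - th * g) + a ^+ 2 * m + k.
  by rewrite th2; ring.
lra.
Qed.

Lemma card_offGamma_small (R : realType) (delta : R) : 0 < delta <= 1 ->
  exists2 c : R, 0 < c & exists g0 : nat, forall g k m, (g0 <= g)%N ->
    k%:R <= delta ^+ 2 / 24 * g%:R -> (0 < m <= g.+1)%N ->
    delta * g%:R <= `|m%:R - gamma R * g%:R| ->
    #|multFam g m k|%:R <= expR ((lnphi R - c) * g%:R).
Proof.
move=> /andP[d0 d1]; set a := delta / 6.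
have a0 : 0 < a by rewrite divr_gt0.
have ad : 6 * a = delta by rewrite /a; field.
have a1 : 6 * a <= 1 by rewrite ad.
have c0 : 0 < 3 / 4 * a ^+ 2 by rewrite mulr_gt0 ?divr_gt0 ?exprn_gt0.
exists (3 / 4 * a ^+ 2) => //; have [g0 g0P] := eventually_le (lnphi R + 2) c0.
exists g0 => g k m hg hk /andP[m0 mg] hm.
have s1 : 1 <= 1 + invphi R ^+ 2 by rewrite lerDl sqr_ge0.
(* The weight is lowered if the multiplicity is too large and raised if it is too small. *)
pose th := if gamma R * g%:R <= m%:R then - a else a.
have hth : (th = - a /\ 6 * a * g%:R <= m%:R - gamma R * g%:R) \/
           (th = a /\ 6 * a * g%:R <= gamma R * g%:R - m%:R).
  rewrite /th ad; case: ifP hm => [hm1|/negbT]; first by rewrite ger0_norm ?subr_ge0 //; left.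
  by rewrite -ltNge => /ltW hm1; rewrite ler0_norm ?subr_le0 // opprB; right.
have hth2 : -1 <= 2 * th <= 1 by case: hth => -[-> _]; move: a0 a1; clear; lra.
apply: le_trans (multFam_exp g k m0 hth2) _; rewrite ler_expR -(natr1 g).
apply: (@offGamma_arith R (lnphi R) a (1 + invphi R ^+ 2) (gamma R) g%:R m%:R k%:R th a0 a1 (gamma_inv R) s1 _ _ _ hth (g0P _ hg)) => //.
  by rewrite ler0n natr1 ler_nat.
by apply: le_trans hk _; rewrite le_eqVlt; apply/orP; left; apply/eqP; rewrite /a; field.
Qed.

(** * Exchangeability in the window *)

Lemma ext_preimset N (t : {perm 'I_N}) (A : {set 'I_N}) (i : 'I_N) :
  ext (t @^-1: A) i = ext A (t i).
Proof. by rewrite !ext_ord inE. Qed.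

Lemma card_preimset_perm (T : finType) (t : {perm T}) (A : {set T}) : #|t @^-1: A| = #|A|.
Proof.
rewrite -(card_imset (t @^-1: A) (@perm_inj _ t)); congr #|pred_of_set _|.
apply/setP => i; apply/imsetP/idP => [[j]|iA]; first by rewrite inE => h ->.
by exists (t^-1%g i); rewrite ?inE permKV.
Qed.

Lemma preimset_perm_inj (T : finType) (t : {perm T}) : injective (fun A : {set T} => t @^-1: A).
Proof.
move=> A B e; apply/setP => i; have := congr1 (fun X : {set T} => t^-1%g i \in X) e.
by rewrite !inE permKV.
Qed.

Definition window g m k : {set 'I_(2 * g).+1} := [set i : 'I_(2 * g).+1 | (m + k < i < 2 * m)%N].

(* Two nonzero elements outside the window sum above it, two elements one of
   which lies in it sum above the largest possible gap. *)
Lemma multFam_swap g m k (i j : 'I_(2 * g).+1) A :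
  i \in window g m k -> j \in window g m k -> A \in multFam g m k ->
  tperm i j @^-1: A \in multFam g m k.
Proof.
rewrite ![_ \in window _ _ _]inE => /andP[i1 i2] /andP[j1 j2].
rewrite ![_ \in multFam _ _ _]inE => /andP[/in_SG[A0 add hg] /asboolP[Am low high]].
set B := _ @^-1: A.
have fixed n : ~~ (m + k < n < 2 * m)%N -> ext B n = ext A n.
  move=> hn; case: (ltnP n (2 * g).+1) => nN; last by rewrite !ext_out.
  rewrite -[n]/(val (Ordinal nN)) ext_preimset tpermD //; apply/eqP => e.
    by move: hn; rewrite -[n]/(val (Ordinal nN)) -e i1 i2.
  by move: hn; rewrite -[n]/(val (Ordinal nN)) -e j1 j2.
have lowB n : (0 < n < m)%N -> ~~ ext B n.
  by move=> hn; rewrite fixed ?low //; move: hn; clear; lia.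
have highB n : (2 * m + k <= n)%N -> ext B n.
  by move=> hn; rewrite fixed ?high //; move: hn; clear; lia.
have geB n : ext B n -> (0 < n)%N -> (m <= n)%N.
  by move=> hn n0; rewrite leqNgt; apply: contraL hn => nm; rewrite lowB ?n0.
apply/andP; split; last first.
  by apply/asboolP; split=> //; rewrite fixed //; clear; lia.
rewrite inE; apply/asboolP; split.
- by rewrite fixed.
- move=> a b Ba Bb; case: (posnP a) => [->|a0]; first by rewrite add0n.
  case: (posnP b) => [->|b0]; first by rewrite addn0.
  have am := geB _ Ba a0; have bm := geB _ Bb b0.
  case: (leqP (2 * m + k) (a + b)) => [/highB //|ab].
  rewrite fixed; last by move: am bm; clear; lia.
  by apply: add; rewrite -fixed //; move: am bm ab; clear; lia.
by rewrite -preimsetC card_preimset_perm.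
Qed.

Definition multFamC g m k (C : {set 'I_(2 * g).+1}) : {set {set 'I_(2 * g).+1}} :=
  [set A in multFam g m k | C \subset A].

Lemma card_multFamC_swap g m k (C : {set 'I_(2 * g).+1}) i j :
  i \in window g m k -> j \in window g m k -> i \notin C -> j \notin C ->
  #|multFamC m k (i |: C)| = #|multFamC m k (j |: C)|.
Proof.
suff le i' j' : i' \in window g m k -> j' \in window g m k -> i' \notin C -> j' \notin C ->
    (#|multFamC m k (i' |: C)| <= #|multFamC m k (j' |: C)|)%N.
  by move=> iW jW iC jC; apply/eqP; rewrite eqn_leq !le.
move=> iW jW iC jC; rewrite -(card_imset _ (@preimset_perm_inj _ (tperm i' j'))).
apply/subset_leq_card/subsetP => _ /imsetP[A + ->]; rewrite ![_ \in multFamC _ _ _]inE => /andP[AF sub].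
rewrite multFam_swap //=; apply/subsetP => s; rewrite [_ \in _ @^-1: _]inE.
move=> /setU1P[->|sC]; first by rewrite tpermR (subsetP sub) // setU11.
by rewrite tpermD ?(subsetP sub) ?setU1r //; [apply: contraNneq iC|apply: contraNneq jC] => ->.
Qed.

(** By exchangeability every window point outside C gives the same count as i; then the pairs (j, A)
    with j in A are counted in both orders. *)
Lemma sum_multFamC g m k (C : {set 'I_(2 * g).+1}) i :
  i \in window g m k -> i \notin C -> C \subset window g m k ->
  ((#|window g m k| - #|C|) * #|multFamC m k (i |: C)| =
   \sum_(A in multFamC m k C) (#|window g m k :&: A| - #|C|))%N.
Proof.
move=> iW iC CW.
have <- : (#|window g m k :\: C| = #|window g m k| - #|C|)%N.
  by rewrite cardsD (setIidPr CW).
rewrite -sum_nat_const.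
rewrite (eq_bigr (fun j => #|multFamC m k (j |: C)|)); last first.
  by move=> j; rewrite inE => /andP[jC jW]; apply: card_multFamC_swap.
transitivity (\sum_(j in window g m k :\: C) \sum_(A in multFamC m k C) (j \in A : nat))%N.
  apply: eq_bigr => j _; rewrite -sum1_card big_mkcond [RHS]big_mkcond; apply: eq_bigr => A _.
  by rewrite !inE subUset sub1set; case: (asbool _) => //=; case: (asbool _) => //=; case: (j \in A); case: (C \subset A).
rewrite exchange_big /=; apply: eq_bigr => A; rewrite inE => /andP[_ CA].
have -> : (#|window g m k :&: A| - #|C| = #|(window g m k :&: A) :\: C|)%N.
  by rewrite cardsD (setIidPr (_ : C \subset _)) // subsetI CW.
rewrite -sum1_card big_mkcond [RHS]big_mkcond; apply: eq_bigr => j _.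
by rewrite !in_setD in_setI; case: (j \in C); case: (j \in window _ _ _); case: (j \in A).
Qed.

Lemma card_sum_bool N (P : pred nat) : (#|[set i : 'I_N | P i]| = \sum_(j < N) P j)%N.
Proof.
by rewrite -sum1_card big_mkcond; apply: eq_bigr => j _; rewrite inE; case: (P j).
Qed.

Lemma card_window g m k : (m <= g)%N -> #|window g m k| = (m - k.+1)%N.
Proof.
move=> mg; rewrite (card_sum_bool _ (fun i => (m + k < i < 2 * m)%N)) sum_interval.
by move: mg; clear; lia.
Qed.

(** Apart from 1, ..., m - 1 and the window, gaps can only lie in the two intervals of length k
    starting at m + 1 and at 2 m. *)
Lemma window_gaps g m k A : (0 < m <= g)%N -> A \in multFam g m k ->
  (m.-1 + #|window g m k :\: A| <= g <= m.-1 + #|window g m k :\: A| + 2 * k)%N.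
Proof.
move=> /andP[m0 mg]; rewrite [_ \in multFam _ _ _]inE => /andP[/in_SG[A0 _ hg] /asboolP[Am low high]].
have -> : #|window g m k :\: A| = (\sum_(j < (2 * g).+1) ((m + k < j < 2 * m) && ~~ ext A j))%N.
  rewrite -sum1_card big_mkcond; apply: eq_bigr => j _; rewrite !inE ext_ord.
  by case: (j \in A); case: (_ < _ < _)%N.
have total : (\sum_(j < (2 * g).+1) ~~ ext A j = g)%N.
  by rewrite (sum_gaps_eq (A := A)) // => n; apply: ext_out.
have e1 : m.-1 = (\sum_(j < (2 * g).+1) (1 <= j < m))%N.
  by rewrite sum_interval; move: m0 mg; clear; lia.
apply/andP; split.
  rewrite -[leqRHS]total e1 -big_split; apply: leq_sum => j _ /=.
  case: (boolP (0 < j < m)%N) => hj; first by rewrite low //; move: hj; clear; lia.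
  by case: (_ < _ < _)%N; case: ext.
apply: (@leq_trans (m.-1 + \sum_(j < (2 * g).+1) ((m + k < j < 2 * m) && ~~ ext A j) +
   (\sum_(j < (2 * g).+1) (m.+1 <= j < (m + k).+1) +
    \sum_(j < (2 * g).+1) (2 * m <= j < 2 * m + k)))%N).
  rewrite -[leqLHS]total e1 -!big_split; apply: leq_sum => j _ /=.
  case: (boolP (ext A j)) => // hj.
  have j0 : (0 < j)%N by rewrite lt0n; apply: contraNneq hj => ->.
  have jm : (j != m :> nat) by apply: contraNneq hj => ->.
  have j2 : (j < 2 * m + k)%N by rewrite ltnNge; apply: contra hj; apply: high.
  by move: j0 jm j2; clear; lia.
by rewrite leq_add2l !sum_interval; clear; lia.
Qed.

(** The gaps of the window avoid C and form about the fraction [invphi]^2 of the other points. So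
    members form about 1 - [invphi]^2 = [invphi] of them, and [sum_multFamC] turns this density into
    a ratio of counts. *)
Lemma multFamC_step (R : realType) (eta : R) g m k (C : {set 'I_(2 * g).+1}) i :
  (0 < m <= g)%N -> C \subset window g m k -> i \in window g m k -> i \notin C ->
  (forall n, (m.-1 + n <= g <= m.-1 + n + 2 * k)%N ->
    `|invphi R ^+ 2 * (#|window g m k|%:R - #|C|%:R) - n%:R|
       <= eta * (#|window g m k|%:R - #|C|%:R)) ->
  `|#|multFamC m k (i |: C)|%:R - invphi R * #|multFamC m k C|%:R|
     <= eta * #|multFamC m k C|%:R.
Proof.
move=> hm CW iW iC heta; set W := window g m k in CW iW heta *.
set w := #|W|%:R - #|C|%:R in heta *.
have CW_lt : (#|C| < #|W|)%N.
  have : (#|i |: C| <= #|W|)%N by rewrite subset_leq_card // subUset sub1set iW.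
  by rewrite cardsU1 iC.
have w0 : 0 < w by rewrite subr_gt0 ltr_nat.
have e : w * (#|multFamC m k (i |: C)|%:R - invphi R * #|multFamC m k C|%:R) =
    \sum_(A in multFamC m k C) (invphi R ^+ 2 * w - #|W :\: A|%:R).
  have := congr1 (fun n => n%:R : R) (sum_multFamC iW iC CW); rewrite -/W natrM natrB 1?ltnW //.
  rewrite -/w mulrBr => ->; rewrite natr_sum.
  have -> : w * (invphi R * #|multFamC m k C|%:R) = \sum_(A in multFamC m k C) invphi R * w.
    by rewrite sumr_const -mulr_natr; ring.
  rewrite -sumrB; apply: eq_bigr => A; rewrite inE => /andP[_ CA].
  have CWA : (#|C| <= #|W :&: A|)%N by rewrite subset_leq_card // subsetI CW.
  rewrite natrB // (_ : invphi R ^+ 2 = 1 - invphi R); last first.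
    by rewrite -(invphi_sq R) addrC addKr.
  by rewrite /w -(cardsID A W) natrD; ring.
rewrite -(ler_pM2l w0) -{1}(gtr0_norm w0) -normrM e.
apply: le_trans (ler_norm_sum _ _ _) _.
apply: (@le_trans _ _ (\sum_(A in multFamC m k C) eta * w)).
  by apply: ler_sum => A; rewrite inE => /andP[AF _]; apply: heta; apply: window_gaps.
rewrite sumr_const -[leLHS]mulr_natr (_ : eta * w * _ = w * (eta * #|multFamC m k C|%:R)) //; ring.
Qed.

(** The points of C are removed one at a time; the errors merely add up, because [invphi] is below 1
    and the counts do not exceed that of [multFam]. *)
Lemma multFamC_product (R : realType) (eta : R) l g m k (C : {set 'I_(2 * g).+1}) :
  (0 < m <= g)%N -> C \subset window g m k -> (#|C| <= l)%N -> 0 <= eta ->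
  (forall n j, (j < l)%N -> (m.-1 + n <= g <= m.-1 + n + 2 * k)%N ->
    `|invphi R ^+ 2 * (#|window g m k|%:R - j%:R) - n%:R|
       <= eta * (#|window g m k|%:R - j%:R)) ->
  `|#|multFamC m k C|%:R - invphi R ^+ #|C| * #|multFam g m k|%:R|
     <= #|C|%:R * eta * #|multFam g m k|%:R.
Proof.
move=> hm CW Cl eta0 heta; move e : #|C| Cl => c; elim: c C e CW => [|c IH] C e CW cl.
  have -> : multFamC m k C = multFam g m k.
    by apply/setP => A; rewrite inE (cards0_eq e) sub0set andbT.
  by rewrite expr0 mul1r subrr normr0 !mul0r.
have [i iC] : exists i, i \in C by apply/card_gt0P; rewrite e.
have eD : #|C :\ i| = c by move: e; rewrite (cardsD1 i) iC => -[].
have DW : C :\ i \subset window g m k by apply: subset_trans CW; apply: subD1set.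
have iD : i \notin C :\ i by rewrite in_setD1 eqxx.
have h1 := IH _ eD DW (ltnW cl).
have h2 := @multFamC_step R eta g m k (C :\ i) i hm DW (subsetP CW i iC) iD.
rewrite setD1K // eD in h2; have {}h2 := h2 (fun n => heta n c cl).
have sub : #|multFamC m k (C :\ i)|%:R <= #|multFam g m k|%:R :> R.
  by rewrite ler_nat subset_leq_card //; apply/subsetP => A; rewrite inE => /andP[].
set G := #|multFam g m k|%:R in sub h1 *; set G1 := #|multFamC m k C|%:R in h2 *.
set G2 := #|multFamC m k (C :\ i)|%:R in sub h1 h2.
have -> : G1 - invphi R ^+ c.+1 * G = (G1 - invphi R * G2) + invphi R * (G2 - invphi R ^+ c * G).
  by rewrite exprS; ring.
have /andP[x0 x1] := invphi_itv R.
apply: le_trans (ler_normD _ _) _; rewrite normrM (gtr0_norm x0).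
rewrite -natr1 mulrDl mul1r mulrDl addrC; apply: lerD.
  by apply: le_trans h1; rewrite ler_piMl // ltW.
by apply: le_trans h2 _; rewrite ler_wpM2l.
Qed.

(** * Decomposition by multiplicity *)

Lemma multFam_sub g m k A : A \in multFam g m k -> A \in SG g.
Proof. by rewrite inE => /andP[]. Qed.

Lemma multFam_unique g m m' k A : A \in multFam g m k -> A \in multFam g m' k ->
  (0 < m)%N -> (0 < m')%N -> m = m'.
Proof.
rewrite inE => /andP[_ /asboolP[Am low _]]; rewrite inE => /andP[_ /asboolP[Am' low' _]] m0 m0'.
apply/eqP; rewrite eqn_leq; apply/andP; split; rewrite leqNgt; apply/negP => h.
  by have := low m'; rewrite m0' h Am' => /(_ isT).
by have := low' m; rewrite m0 h Am => /(_ isT).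
Qed.

Lemma multFam_farGap g m k A : A \in multFam g m k -> A \in farGap g k -> False.
Proof.
rewrite inE => /andP[_ /asboolP[_ low high]]; rewrite inE => /andP[_ /asboolP[m' [F [m0 Am' gapF hF]]]].
have mm' : (m <= m')%N by rewrite leqNgt; apply/negP => h; have := low m'; rewrite m0 h Am' => /(_ isT).
by move/negP: gapF; apply; apply: high; move: mm' hF; clear; lia.
Qed.

Lemma multFam_exists g k A : A \in SG g -> A \notin farGap g k ->
  exists2 m, (0 < m <= g.+1)%N & A \in multFam g m k.
Proof.
move=> SA nbad; have [A0 add hg] := in_SG SA.
have ex : exists m, (0 < m)%N && ext A m by exists (2 * g).+1; rewrite ext_out.
have [m /andP[m0 Am] mmin] := ex_minnP ex.
have low n : (0 < n < m)%N -> ~~ ext A n.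
  move=> /andP[n0 nm]; apply/negP => An.
  by have := mmin n; rewrite n0 An => /(_ isT); rewrite leqNgt nm.
exists m.
  have e1 : (\sum_(j < m) (1 <= j < m) = m.-1)%N by rewrite sum_interval; clear; lia.
  have : (m.-1 <= g)%N.
    rewrite -[leqRHS]hg -e1; apply: leq_trans (sum_gaps_le A m); apply: leq_sum => j _.
    by case: (boolP (0 < j < m)%N) => // /low ->.
  by move: m0; clear; lia.
rewrite inE SA; apply/asboolP; split=> // n hn; apply: contraT => gap.
by case/negP: nbad; rewrite inE SA; apply/asboolP; exists m, n.
Qed.

Lemma card_SG_split g k (Q : pred {set 'I_(2 * g).+1}) :
  #|[set A in SG g | Q A]| = (#|[set A in farGap g k | Q A]| +
    \sum_(m < g.+2 | (0 < m)%N) #|[set A in multFam g m k | Q A]|)%N.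
Proof.
have ind (X : {set {set 'I_(2 * g).+1}}) : #|[set A in X | Q A]| = (\sum_A ((A \in X) && Q A))%N.
  by rewrite -sum1_card big_mkcond; apply: eq_bigr => A _; rewrite [_ \in [set _ in _ | _]]inE; case: ifP.
rewrite !ind (eq_bigr (fun m : 'I_g.+2 => \sum_A ((A \in multFam g m k) && Q A))%N); last first.
  by move=> m _; apply: ind.
rewrite exchange_big -big_split; apply: eq_bigr => A _ /=.
case: (boolP (Q A)) => QA; last by rewrite andbF andbF big1 // => m _; rewrite andbF.
rewrite !andbT; case: (boolP (A \in farGap g k)) => hb.
  rewrite big1 => [|m _]; first by move: hb; rewrite inE => /andP[->].
  by rewrite andbT; case: (boolP (A \in multFam _ _ _)) => // /multFam_farGap /(_ hb).
case: (boolP (A \in SG g)) => SA.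
  have [m /andP[m0 mg] hm] := multFam_exists SA hb.
  rewrite (bigD1 (Ordinal (mg : (m < g.+2)%N))) //= hm big1 // => i /andP[i0 im].
  case: (boolP (A \in multFam g i k)) => // hi; case/eqP: im; apply: val_inj => /=.
  exact: multFam_unique hi hm i0 m0.
by rewrite big1 // => m _; case: (boolP (A \in multFam _ _ _)) => // /multFam_sub h; rewrite h in SA.
Qed.

(** On any class the deviation is at most the size of the class, which suffices for [farGap] and for
    bad multiplicities. The index m ranges over fewer than g + 3 values, whence the factor g + 3
    once [farGap] is included. *)
Lemma deviation_bound (R : realType) (pr eta Bd : R) g k (Q : pred {set 'I_(2 * g).+1})
    (good : pred nat) :
  0 <= pr <= 1 -> 0 <= eta -> #|farGap g k|%:R <= Bd ->
  (forall m, (0 < m <= g.+1)%N -> good m ->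
     `|#|[set A in multFam g m k | Q A]|%:R - pr * #|multFam g m k|%:R|
       <= eta * #|multFam g m k|%:R) ->
  (forall m, (0 < m <= g.+1)%N -> ~~ good m -> #|multFam g m k|%:R <= Bd) ->
  `|#|[set A in SG g | Q A]|%:R - pr * #|SG g|%:R| <= (g + 3)%:R * Bd + eta * #|SG g|%:R.
Proof.
move=> /andP[pr0 pr1] eta0 hbad hgood hbadm.
have Bd0 : 0 <= Bd by apply: le_trans hbad.
have trivial_dev (X : {set {set 'I_(2 * g).+1}}) :
    `|#|[set A in X | Q A]|%:R - pr * #|X|%:R| <= #|X|%:R.
  have h : #|[set A in X | Q A]|%:R <= #|X|%:R :> R.
    by rewrite ler_nat subset_leq_card //; apply/subsetP => A; rewrite inE => /andP[].
  have h0 : 0 <= #|[set A in X | Q A]|%:R :> R by [].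
  have h1 : 0 <= pr * #|X|%:R by rewrite mulr_ge0.
  have h2 : pr * #|X|%:R <= #|X|%:R by rewrite ler_piMl.
  by rewrite ler_norml; apply/andP; split; lra.
have split0 : #|SG g| = (#|farGap g k| + \sum_(m < g.+2 | (0 < m)%N) #|multFam g m k|)%N.
  have setT_id (X : {set {set 'I_(2 * g).+1}}) : [set A in X | predT A] = X.
    by apply/setP => A; rewrite inE andbT.
  have := @card_SG_split g k predT; rewrite !setT_id => ->.
  by congr addn; apply: eq_bigr => m _; rewrite setT_id.
have sumM : \sum_(m < g.+2 | (0 < m)%N) #|multFam g m k|%:R <= #|SG g|%:R :> R.
  by rewrite split0 natrD natr_sum lerDr.
rewrite (card_SG_split k Q) [in X in pr * X]split0 !natrD !natr_sum mulrDr mulr_sumr opprD addrACA -sumrB.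
apply: le_trans (ler_normD _ _) _.
have -> : (g%:R + 3%:R) * Bd = Bd + g.+2%:R * Bd by rewrite -[g.+2]addn2 natrD; ring.
rewrite -[leRHS]addrA; apply: lerD; first exact: le_trans (trivial_dev _) hbad.
apply: le_trans (ler_norm_sum _ _ _) _.
apply: (@le_trans _ _ (\sum_(m < g.+2 | (0 < m)%N) (Bd + eta * #|multFam g m k|%:R))).
  apply: ler_sum => m m0; have hm : (0 < m <= g.+1)%N by rewrite m0 -ltnS ltn_ord.
  case: (boolP (good m)) => gm.
    by apply: le_trans (hgood m hm gm) _; rewrite lerDr.
  apply: le_trans (trivial_dev _) _; apply: le_trans (hbadm m hm gm) _.
  by rewrite lerDl mulr_ge0.
rewrite big_split /= -mulr_sumr; apply: lerD; last by rewrite ler_wpM2l.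
rewrite sumr_const -[leLHS]mulr_natl ler_wpM2r // ler_nat.
by rewrite -[leqRHS]card_ord max_card.
Qed.

(** * The limit function and the final estimate *)

Lemma gamma_bounds (R : realType) : 72 / 100 < gamma R < 73 / 100.
Proof.
have /andP[lo hi] := sqrt5_bounds R; rewrite /gamma; move: (Num.sqrt 5) lo hi => s lo hi.
by rewrite ltr_pdivlMr // ltr_pdivrMr //; apply/andP; split; lra.
Qed.

Lemma f1_low (R : realType) (t : R) : t < gamma R -> f1 t = 0.
Proof. by rewrite /f1 => ->. Qed.

Lemma f1_mid (R : realType) (t : R) : gamma R < t -> t < 2 * gamma R -> f1 t = invphi R.
Proof. by rewrite /f1 => h1 h2; rewrite ltNge (ltW h1) h1 h2. Qed.

Lemma f1_high (R : realType) (t : R) : 2 * gamma R < t -> f1 t = 1.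
Proof.
move=> h; have g0 : 0 < gamma R by have /andP[+ _] := gamma_bounds R; apply: lt_trans; rewrite divr_gt0.
have h1 : gamma R < t by apply: lt_trans h; rewrite ltr_pMl // ltrDl.
by rewrite /f1 ltNge (ltW h1) h1 ltNge (ltW h) h.
Qed.

(** Since ga (1 + q) = 1, the main terms cancel, leaving (1 + q) (m - ga g), q (k + 1 + j) and g - m
    - n. Together these stay below eta g / 2, whereas w - j is at least g / 2. *)
Lemma window_arith (R : realFieldType) (q ga eta de g m k j l n w : R) :
  0 <= q <= 1 -> ga * (1 + q) = 1 -> 72 / 100 < ga -> 0 < eta -> 0 <= g ->
  de <= eta / 20 -> de <= 1 / 100 -> 0 <= k <= de * g -> 0 <= j -> j + 1 <= l ->
  l + 2 <= eta / 4 * g -> l + 2 <= g / 10 ->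
  `|m - ga * g| <= de * g -> m - 1 + n <= g <= m - 1 + n + 2 * k -> w = m - (k + 1) ->
  `|q * (w - j) - n| <= eta * (w - j).
Proof.
move=> /andP[q0 q1] gq ga0 eta0 g0 de1 de2 /andP[k0 k1] j0 jl l1 l2 hm /andP[n1 n2] ->.
have d1 : de * g <= eta / 20 * g by rewrite ler_wpM2r.
have d2 : de * g <= 1 / 100 * g by rewrite ler_wpM2r.
have g1 : 72 / 100 * g <= ga * g by rewrite ler_wpM2r // ltW.
move: hm; rewrite ler_norml => /andP[m1 m2].
have w_ge : g / 2 <= m - (k + 1) - j by lra.
have ew : eta * (g / 2) <= eta * (m - (k + 1) - j) by rewrite ler_wpM2l // ltW.
have e1 : q * (m - (k + 1) - j) - n = (1 + q) * (m - ga * g) - q * (k + 1 + j) + (g - m - n).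
  have -> : (1 + q) * (m - ga * g) = (1 + q) * m - ga * (1 + q) * g by ring.
  by rewrite gq; ring.
have q2 : 0 <= q * (k + 1 + j) <= k + 1 + j.
  by apply/andP; split; [rewrite mulr_ge0 //; lra|rewrite ler_piMl //; lra].
have q3 : - (2 * (de * g)) <= (1 + q) * (m - ga * g) <= 2 * (de * g).
  rewrite -ler_norml normrM ger0_norm; last by lra.
  apply: ler_pM; rewrite ?normr_ge0 ?ler_norml ?m1 ?m2 //; lra.
move: q2 q3 => /andP[q2 q2'] /andP[q3 q3'].
by rewrite e1 ler_norml; apply/andP; split; lra.
Qed.

Lemma eventually_negligible (R : realType) (c eps : R) : 0 < c -> 0 < eps ->
  exists g0 : nat, forall g, (g0 <= g)%N -> 2 * (g + 3)%:R * expR (- c * g%:R) <= eps.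
Proof.
move=> c0 eps0; have c2 : 0 < c / 2 by rewrite divr_gt0.
have [g1 g1P] := eventually_poly c2; have [g2 g2P] := eventually_le eps^-1 c2.
exists (g1 + g2 + 1)%N => g hg.
have [hg1 hg2 hg3] : [/\ (g1 <= g)%N, (g2 <= g)%N & (0 < g)%N] by move: hg; clear; split; lia.
have -> : - c * g%:R = - (c / 2 * g%:R) - c / 2 * g%:R by field.
rewrite expRD mulrA -[leRHS]mul1r; apply: ler_pM; rewrite ?mulr_ge0 ?expR_ge0 //.
  rewrite expRN ler_pdivrMr ?expR_gt0 // mul1r; apply: le_trans (g1P _ hg1).
  by rewrite ler_pM2l // ler_nat; move: hg3; clear; nia.
rewrite expRN -[leRHS]invrK lef_pV2 ?posrE ?expR_gt0 ?invr_gt0 //.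
apply: le_trans (g2P _ hg2) _; apply: le_trans (expR_ge1Dx _); by rewrite lerDr.
Qed.

(** This allows the excluded neighbourhoods to be taken as narrow as the estimates require. *)
Lemma admissible_shrink (R : realType) (e e' : R) g n : e' <= e -> admissible e g n -> admissible e' g n.
Proof.
move=> ee; have h : e' * g%:R <= e * g%:R by rewrite ler_wpM2r.
rewrite /admissible => /or3P[/andP[-> h1]|/andP[h1 h2]|/andP[h1 ->]]; apply/or3P.
- by apply: Or31; move: h1; rewrite !mulrBl; lra.
- by apply: Or32; apply/andP; split; move: h1 h2; rewrite !(mulrBl, mulrDl); lra.
- by apply: Or33; rewrite andbT; move: h1; rewrite !mulrDl; lra.
Qed.

Lemma admissible_le (R : realType) (e : R) g n : 0 < e -> admissible e g n -> (n <= 2 * g)%N.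
Proof.
move=> e0; have /andP[_ ga] := gamma_bounds R; have g0 : 0 <= g%:R :> R by [].
have eg : 0 <= e * g%:R by rewrite mulr_ge0 // ltW.
have gg : gamma R * g%:R <= 73 / 100 * g%:R by rewrite ler_wpM2r // ltW.
rewrite -(ler_nat R) natrM.
by rewrite /admissible => /or3P[/andP[_ h1]|/andP[_ h2]|/andP[_ //]];
  [move: h1|move: h2]; rewrite !mulrBl; lra.
Qed.

Definition below (R : realType) (e : R) (g n : nat) : bool := n%:R < (gamma R - e) * g%:R.

Definition between (R : realType) (e : R) (g n : nat) : bool :=
  ((gamma R + e) * g%:R < n%:R) && (n%:R < (2 * gamma R - e) * g%:R).

Lemma prod_f1 (R : realType) (e : R) g (C : {fset nat}) : 0 < e -> (0 < g)%N ->
  (forall n, (n \in C)%fset -> admissible e g n) ->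
  \prod_(n <- C) f1 (n%:R / g%:R) =
    if has (below e g) C then 0 else invphi R ^+ count (between e g) C.
Proof.
move=> e0 g_gt0 hC; have g0 : 0 < g%:R :> R by rewrite ltr0n.
have eg : 0 < e * g%:R by rewrite mulr_gt0.
case: ifP => [/hasP[n nC nlow]|/hasPn nolow].
  rewrite (big_rem n) //= f1_low ?mul0r // ltr_pdivrMr //.
  by move: nlow; rewrite /below mulrBl; lra.
have -> : invphi R ^+ count (between e g) C =
    \prod_(n <- C) (if between e g n then invphi R else 1).
  by rewrite -big_mkcond big_const_seq; elim: count => //= i <-; rewrite exprS.
rewrite big_seq [RHS]big_seq; apply: eq_bigr => n nC.
have := hC n nC; rewrite /admissible => /or3P[/andP[_ h]|h|/andP[h _]].
- by have := nolow n nC; rewrite /below h.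
- rewrite /between h; move: h => /andP[h1 h2]; apply: f1_mid.
    by rewrite ltr_pdivlMr //; move: h1; rewrite mulrDl; lra.
  by rewrite ltr_pdivrMr //; move: h2; rewrite mulrBl; lra.
rewrite f1_high; last by rewrite ltr_pdivlMr //; move: h; rewrite mulrDl; lra.
rewrite /between ifF //; apply/negbTE/negP => /andP[_ h2].
by move: h h2; rewrite mulrDl mulrBl; lra.
Qed.

Lemma card_fset_filter N (C : {fset nat}) (P : pred nat) :
  (forall n, (n \in C)%fset -> (n < N)%N) ->
  #|[set i : 'I_N | (val i \in C) && P i]| = count P C.
Proof.
move=> hC; rewrite -size_filter cardE -(size_map val); apply: perm_size; apply: uniq_perm.
- by rewrite map_inj_uniq ?enum_uniq //; apply: val_inj.
- by rewrite filter_uniq // fset_uniq.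
move=> n; rewrite mem_filter; apply/mapP/andP => [[i]|[Pn nC]].
  by rewrite mem_enum inE => /andP[iC Pi] ->.
by exists (Ordinal (hC n nC)); rewrite // mem_enum inE /= nC.
Qed.

(** With m within de g of gamma g, points of the lowest interval lie below m and are gaps, points of
    the highest lie beyond 2 m + k and are members, and points of the middle one lie in the window.
    So either no semigroup qualifies or only the middle points impose a condition. *)
Lemma multFam_deviation (R : realType) (e de eta : R) l g m k (C : {fset nat}) :
  0 < e -> 8 * de <= e -> k%:R <= de * g%:R -> (0 < m <= g)%N -> 0 <= eta ->
  `|m%:R - gamma R * g%:R| < de * g%:R ->
  (forall n, (n \in C)%fset -> admissible e g n) -> #|` C|%fset = l ->
  (forall n j, (j < l)%N -> (m.-1 + n <= g <= m.-1 + n + 2 * k)%N ->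
    `|invphi R ^+ 2 * (#|window g m k|%:R - j%:R) - n%:R|
       <= eta * (#|window g m k|%:R - j%:R)) ->
  `|#|[set A in multFam g m k | all (ext A) C]|%:R -
     (\prod_(n <- C) f1 (n%:R / g%:R)) * #|multFam g m k|%:R|
    <= l%:R * eta * #|multFam g m k|%:R.
Proof.
move=> e0 de0 hk hm eta0 hmg hC Cl heta; have [m0 mg] := andP hm.
have g_gt0 : (0 < g)%N by apply: leq_trans mg.
have gR : 0 < g%:R :> R by rewrite ltr0n.
have dg : 8 * (de * g%:R) <= e * g%:R by rewrite mulrA ler_wpM2r.
have eg : 0 < e * g%:R by rewrite mulr_gt0.
move: hmg; rewrite ltr_norml => /andP[m_lo m_hi].
rewrite (prod_f1 e0 g_gt0 hC); case: ifP => [/hasP[n nC nlow]|/hasPn nolow].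
  rewrite (_ : [set A in _ | _] = set0); first by rewrite cards0 mul0r subrr normr0 !mulr_ge0.
  have ga0 : 0 < gamma R by have /andP[+ _] := gamma_bounds R; apply: lt_trans; rewrite divr_gt0.
  apply/setP => A; rewrite [RHS]inE [LHS]inE; apply/negbTE/negP => /andP[+ /allP/(_ n nC)].
  rewrite inE => /andP[_ /asboolP[_ low _]].
  apply/negP; apply: low; apply/andP; split; last first.
    by rewrite -(ltr_nat R); move: nlow; rewrite /below mulrBl; lra.
  have := hC n nC; rewrite /admissible => /or3P[/andP[-> //]|/andP[h _]|/andP[h _]];
    rewrite -(ltr_nat R); apply: le_lt_trans h; apply: mulr_ge0 => //; apply: addr_ge0;
    by [exact: ltW|apply: mulr_ge0 => //; exact: ltW].
set D := [set i : 'I_(2 * g).+1 | (val i \in C) && between e g i].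
have C_lt n : (n \in C)%fset -> (n < (2 * g).+1)%N by move/hC/(admissible_le e0).
have cD : #|D| = count (between e g) C by apply: card_fset_filter.
have DW : D \subset window g m k.
  apply/subsetP => i; rewrite !inE /= => /andP[_ /andP[h1 h2]].
  rewrite -!(ltr_nat R) natrD natrM.
  by apply/andP; split; move: h1 h2; rewrite mulrDl mulrBl -(mulrA 2); lra.
have Dl : (#|D| <= l)%N by rewrite cD -Cl count_size.
have -> : [set A in multFam g m k | all (ext A) C] = multFamC m k D.
  apply/setP => A; rewrite [LHS]inE [RHS]inE; case: (boolP (A \in multFam g m k)) => //= hA.
  move: hA; rewrite inE => /andP[_ /asboolP[_ _ high]].
  apply/allP/subsetP => [h i|h n nC].
    by rewrite inE => /andP[iC _]; rewrite -ext_ord; apply: h.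
  case: (boolP (between e g n)) => hn.
    by rewrite (ext_ord A (Ordinal (C_lt n nC))) h // inE /= nC.
  apply: high; rewrite -(ler_nat R) natrD natrM.
  have := hC n nC; rewrite /admissible => /or3P[/andP[_ h1]|h1|/andP[h1 _]].
  - by have := nolow n nC; rewrite /below h1.
  - by rewrite /between h1 in hn.
  by move: h1; rewrite mulrDl -(mulrA 2); lra.
rewrite -cD; apply: le_trans (multFamC_product hm DW Dl eta0 heta) _.
by rewrite -!mulrA ler_wpM2r ?mulr_ge0 // ler_nat.
Qed.

Theorem theorem6p6 (R : realType) (l : nat) (e1 e2 : R) :
  0 < e1 -> 0 < e2 ->
  exists M : R, 0 < M /\
    forall g : nat, M < g%:R ->
    forall C : {fset nat},
      #|` C |%fset = l ->
      (forall n, (n \in C)%fset -> admissible e1 g n) ->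
      `| prob_contains R g C - \prod_(n <- C) f1 (n%:R / g%:R) | < e2.
Proof.
move=> e1_gt0 e2_gt0.
(* The denominator uses l + 1 so that it is nonzero and l eta < e2 / 2 is strict. The bound 1/100
   later confines good multiplicities between g / 2 and g. *)
pose e := Num.min e1 (1 / 100); pose eta := e2 / (2 * l.+1%:R).
have e0 : 0 < e by rewrite lt_min e1_gt0 divr_gt0.
have e_e1 : e <= e1 by rewrite ge_min lexx.
have e_100 : e <= 1 / 100 by rewrite ge_min lexx orbT.
have eta0 : 0 < eta by rewrite divr_gt0 // mulr_gt0.
pose de := Num.min (e / 8) (eta / 20).
have de0 : 0 < de by rewrite lt_min; apply/andP; split; apply: divr_gt0.
have de_e : 8 * de <= e by rewrite mulrC -ler_pdivlMr // ge_min lexx.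
have de_eta : de <= eta / 20 by rewrite ge_min lexx orbT.
have de_100 : de <= 1 / 100 by move: de0 de_e e_100; clear; lra.
have de_1 : de <= 1 by move: de_100; clear; lra.
have dk0 : 0 < de ^+ 2 / 48 by rewrite divr_gt0 ?exprn_gt0.
have dk_de : de ^+ 2 / 24 <= de.
  rewrite ler_pdivrMr // expr2 ler_pM2l //; move: de_1; clear; lra.
have [c1 c1_gt0 [g1 farGapP]] := card_farGap_small dk0.
have [c2 c2_gt0 [g2 offGammaP]] := card_offGamma_small (introT andP (conj de0 de_1)).
pose c := Num.min c1 c2; have c_gt0 : 0 < c by rewrite lt_min c1_gt0.
have [g3 g3P] := eventually_negligible c_gt0 (divr_gt0 e2_gt0 (ltr0n R 2)).
have [g4 g4P] := eventually_le 1 dk0.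
have eta4 : 0 < eta / 4 by rewrite divr_gt0.
have [g5 g5P] := eventually_le (l%:R + 2) eta4.
have [g6 g6P] := eventually_le (l%:R + 2) (divr_gt0 ltr01 (ltr0n R 10)).
exists (g1 + g2 + g3 + g4 + g5 + g6 + 1)%:R; split; first by rewrite ltr0n addn1.
move=> g; rewrite ltr_nat => hg C Cl hC.
have [hg1 hg2 hg3 hg4] : [/\ (g1 <= g)%N, (g2 <= g)%N, (g3 <= g)%N & (g4 <= g)%N].
  by move: hg; clear; split; lia.
have [hg5 hg6 g_gt0] : [/\ (g5 <= g)%N, (g6 <= g)%N & (0 < g)%N].
  by move: hg; clear; split; lia.
have gR : 0 < g%:R :> R by rewrite ltr0n.
have hC' n : (n \in C)%fset -> admissible e g n by move/hC/(admissible_shrink e_e1).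
(* k is linear in g, so that [farGap] is exponentially rare, yet of order de^2 g, so that it does
   not spoil the concentration of the multiplicity. *)
pose k := Num.truncn (de ^+ 2 / 24 * g%:R).
have kg0 : 0 <= de ^+ 2 / 24 * g%:R by rewrite mulr_ge0 ?divr_ge0 ?exprn_ge0 // ltW.
have k_le : k%:R <= de ^+ 2 / 24 * g%:R by rewrite truncn_le.
have k_ge : de ^+ 2 / 48 * g%:R <= k%:R.
  have h1 := g4P g hg4; have := ltW (truncnS_gt (de ^+ 2 / 24 * g%:R)); rewrite -/k -(natr1 k).
  by move: h1; clear; lra.
have k_de : k%:R <= de * g%:R by apply: le_trans k_le _; rewrite ler_wpM2r.
pose pr : R := \prod_(n <- C) f1 (n%:R / g%:R).
have pr01 : 0 <= pr <= 1.
  rewrite /pr (prod_f1 e0 g_gt0 hC'); case: ifP; rewrite ?lexx ?ler01 // => _.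
  have /andP[x0 x1] := invphi_itv R.
  by rewrite exprn_ge0 ?exprn_ile1 // ltW.
pose good m := `|m%:R - gamma R * g%:R| < de * g%:R.
pose Bd : R := expR ((lnphi R - c) * g%:R).
have Bd_ge c' : c <= c' -> expR ((lnphi R - c') * g%:R) <= Bd.
  by move=> cc; rewrite ler_expR ler_wpM2r // lerD2l lerN2.
have /andP[ga_lo ga_hi] := gamma_bounds R.
have dev : `|#|[set A in SG g | all (ext A) C]|%:R - pr * #|SG g|%:R|
    <= (g + 3)%:R * Bd + l%:R * eta * #|SG g|%:R.
  apply: (@deviation_bound R pr (l%:R * eta) Bd g k (fun A => all (ext A) C) good) => //.
  - by rewrite mulr_ge0 // ltW.
  - by apply: le_trans (farGapP _ _ hg1 k_ge) (Bd_ge _ _); rewrite ge_min lexx.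
  - move=> m /andP[m0 _] gm.
    have [m_ge m_lt] : g%:R / 2 <= m%:R :> R /\ m%:R < g%:R :> R.
      have h1 : 72 / 100 * g%:R <= gamma R * g%:R by rewrite ler_wpM2r // ltW.
      have h2 : gamma R * g%:R <= 73 / 100 * g%:R by rewrite ler_wpM2r // ltW.
      have h3 : de * g%:R <= 1 / 100 * g%:R by rewrite ler_wpM2r.
      by move: gm; rewrite /good ltr_norml => /andP[]; move: h1 h2 h3 gR; clear; split; lra.
    have mg : (m <= g)%N by rewrite -(ler_nat R) ltW.
    have km : (k.+1 <= m)%N.
      rewrite -(ler_nat R) -(natr1 k); have h3 : de * g%:R <= 1 / 100 * g%:R by rewrite ler_wpM2r.
      have h4 := g6P g hg6; have l0 : 0 <= l%:R :> R by [].
      by move: m_ge h3 h4 l0 k_de; clear; lra.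
    have mm : (0 < m <= g)%N by rewrite m0.
    apply: (@multFam_deviation R e de eta l g m k C) => //; first exact: ltW.
    move=> n j jl /andP[n1 n2].
    apply: (@window_arith R (invphi R ^+ 2) (gamma R) eta de g%:R m%:R k%:R j%:R l%:R n%:R).
    + by rewrite sqr_ge0 -(invphi_sq R) lerDr; have /andP[/ltW] := invphi_itv R.
    + exact: gamma_inv.
    + exact: ga_lo.
    + exact: eta0.
    + exact: ltW.
    + exact: de_eta.
    + exact: de_100.
    + by rewrite ler0n k_de.
    + exact: ler0n.
    + by rewrite natr1 ler_nat.
    + exact: g5P.
    + by rewrite mulrC; have := g6P g hg6; rewrite mul1r mulrC.
    + exact: ltW.
    + rewrite -(@natrB R m 1) // subn1 -natrD ler_nat n1 /=.
      by rewrite -natrM -natrD ler_nat.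
    by rewrite natr1 card_window // natrB.
  - move=> m mg ngood; apply: le_trans (offGammaP _ _ _ hg2 k_le mg _) (Bd_ge _ _).
      by rewrite leNgt.
    by rewrite ge_min lexx orbT.
rewrite prob_containsE -/pr; set T : R := #|SG g|%:R in dev *.
(* The Fibonacci lower bound turns the exponential saving relative to phi^g into one relative to the
   number of semigroups. *)
have T_ge : expR (lnphi R * g%:R) <= 2 * T by rewrite -phiX card_SG_ge.
have T0 : 0 < T by rewrite -(pmulr_rgt0 _ (ltr0n R 2)) (lt_le_trans (expR_gt0 _) T_ge).
set P := #|_|%:R in dev *.
have -> : P / T - pr = (P - pr * T) / T by rewrite mulrBl mulfK // gt_eqF.
rewrite normrM normfV (gtr0_norm T0) ltr_pdivrMr //; apply: le_lt_trans dev _.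
have BdE : (g + 3)%:R * Bd <= e2 / 2 * T.
  rewrite /Bd mulrBl expRD mulrCA -mulNr.
  apply: (@le_trans _ _ (2 * T * ((g + 3)%:R * expR (- c * g%:R)))).
    by rewrite ler_wpM2r // mulr_ge0 ?expR_ge0.
  move: (g3P g hg3) => neg; have := ler_wpM2r (ltW T0) neg.
  by congr (_ <= _); ring.
have lE : l%:R * eta < e2 / 2.
  rewrite /eta mulrA ltr_pdivrMr ?mulr_gt0 // (_ : e2 / 2 * (2 * l.+1%:R) = l.+1%:R * e2); last by field.
  by rewrite ltr_pM2r // ltr_nat.
have := ltr_pM2r T0 (l%:R * eta) (e2 / 2); rewrite lE => lT.
have -> : e2 * T = e2 / 2 * T + e2 / 2 * T by field.
by apply: ler_ltD.
Qed.
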